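(* For any $n, k, d \in \mathbb{N}$ and any $\epsilon, \delta, \gamma > 0$, there exists a one-query $(O(\epsilon d), k\delta + \gamma)$-steward for $k$ adaptively chosen $(\epsilon, \delta)$-concentrated functions $f_1, \dots, f_k: \{0,1\}^n \to \mathbb{R}^d$ with randomness complexity \[ n + O(k\log(d+1) + (\log k)\log(1/\gamma)). \] The total running time of the steward is $\mathrm{poly}(n, k, d, \log(1/\epsilon), \log(1/\gamma))$. (All $O(\cdot)$ constants are absolute.)
   Context: A function $f: \{0,1\}^n \to \mathbb{R}^d$ is $(\epsilon,\delta)$-concentrated at $\mu \in \mathbb{R}^d$ if $\Pr_{X \in \{0,1\}^n}[\|f(X) - \mu\|_\infty > \epsilon] \le \delta$, with $X$ uniform. An $(\epsilon', \delta')$-steward for $k$ adaptively chosen $(\epsilon,\delta)$-concentrated functions $f_1,\dots,f_k:\{0,1\}^n \to \mathbb{R}^d$ is a randomized algorithm $\mathsf{S}$ that interacts with an arbitrary (possibly randomized, computationally unbounded) owner $\mathsf{O}$ as follows: for $i = 1,\dots,k$, $\mathsf{O}$ chooses (adaptively, based on everything it has seen) a function $f_i$ that is $(\epsilon,\delta)$-concentrated at some point $\mu_i \in \mathbb{R}^d$ and gives it to $\mathsf{S}$; then $\mathsf{S}$ chooses $Y_i \in \mathbb{R}^d$ and gives it to $\mathsf{O}$. The requirement is that for every owner $\mathsf{O}$, $\Pr[\max_i \|Y_i - \mu_i\|_\infty > \epsilon'] \le \delta'$, the probability taken over the randomness of both. A steward is one-query if it accesses each $f_i$ only by evaluating it at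 a single point $X_i \in \{0,1\}^n$ (not seen by the owner). The randomness complexity is the number of random bits the steward uses. *)

(* Defs.v *)
From mathcomp Require Export all_boot all_order all_algebra.
From mathcomp Require Export all_classical all_reals all_analysis.
Export Order.TTheory GRing.Theory Num.Theory numFieldNormedType.Exports.

Set Implicit Arguments.
Unset Strict Implicit.
Unset Printing Implicit Defensive.

Local Open Scope ring_scope.

(* The norm of ['rV_d] is the sup norm, and it is 0 when [d = 0]. *)
Definition concentrated (R : realType) (n d : nat) (eps delta : R)
    (f : n.-tuple bool -> 'rV[R]_d) (mu : 'rV[R]_d) : Prop :=
  (#|[set X : n.-tuple bool | eps < `|f X - mu|]|)%:R / 2 ^+ n <= delta.

(* An owner with private randomness in [T]. What it does in a given round is a
   function of its randomness [w] and of the list [ys] of the replies received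
   in the previous rounds (its own previous moves are determined by these). *)
Record owner (R : realType) (n d : nat) (eps delta : R) (T : Type) := Owner {
  fct : T -> seq 'rV[R]_d -> n.-tuple bool -> 'rV[R]_d ;
  center : T -> seq 'rV[R]_d -> 'rV[R]_d ;
  fctP : forall w ys, concentrated eps delta (fct w ys) (center w ys) }.

(* The programming language of the stewards. It is the language of a real RAM:
   an unbounded memory of natural numbers, an unbounded memory of exact real
   numbers, unit cost for each command (a program being a fixed syntactic
   object, each of its expressions has constant size). The arithmetic is
   restricted on purpose. The naturals have addition and truncated subtraction,
   so that in [t] steps only integers of O(t) more bits can be produced. The
   reals have addition, subtraction, comparison and rounding down to a multiple;
   as they have no multiplication, unit-cost rounding does not give the known
   unreasonable power of the real RAM with both product and floor. There is no
   conversion from reals to naturals, and there are no real constants. *)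
Inductive nexp :=
  | NConst of nat
  | NLoad of nexp
  | NAdd of nexp & nexp
  | NSub of nexp & nexp.

Inductive rexp :=
  | RNat of nexp
  | RLoad of nexp
  | RAdd of rexp & rexp
  | RSub of rexp & rexp
  | RRound of rexp & rexp.

Inductive bexp :=
  | NLe of nexp & nexp
  | RLe of rexp & rexp.

Inductive com :=
  | Skip
  | NSet of nexp & nexp
  | RSet of nexp & rexp
  | Flip of nexp
  | Query of nexp & nexp
  | Answer of nexp
  | Seq of com & com
  | If of bexp & com & com
  | While of bexp & com.

(* [tape] holds the random bits not read yet; [asked] tells whether the function
   of the current round has already been queried; [replies] lists the points
   given to the owner so far. *)
Record state (R : realType) (d : nat) := State {
  nmem : nat -> nat ;
  rmem : nat -> R ;
  tape : seq bool ;
  asked : bool ;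
  replies : seq 'rV[R]_d }.

Fixpoint neval (nm : nat -> nat) (e : nexp) : nat :=
  match e with
  | NConst c => c
  | NLoad a => nm (neval nm a)
  | NAdd e1 e2 => (neval nm e1 + neval nm e2)%N
  | NSub e1 e2 => (neval nm e1 - neval nm e2)%N
  end.

Fixpoint reval (R : realType) (nm : nat -> nat) (rm : nat -> R) (e : rexp) : R :=
  match e with
  | RNat e1 => (neval nm e1)%:R
  | RLoad a => rm (neval nm a)
  | RAdd e1 e2 => reval nm rm e1 + reval nm rm e2
  | RSub e1 e2 => reval nm rm e1 - reval nm rm e2
  | RRound e1 e2 =>
      (Num.floor (reval nm rm e1 / reval nm rm e2))%:~R * reval nm rm e2
  end.

Definition beval (R : realType) (nm : nat -> nat) (rm : nat -> R) (b : bexp) :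
    bool :=
  match b with
  | NLe e1 e2 => (neval nm e1 <= neval nm e2)%N
  | RLe e1 e2 => reval nm rm e1 <= reval nm rm e2
  end.

Definition upd (V : Type) (m : nat -> V) (a : nat) (v : V) : nat -> V :=
  fun l => if l == a then v else m l.

Definition read_point (n : nat) (nm : nat -> nat) (a : nat) : n.-tuple bool :=
  [tuple nm (a + i)%N != 0%N | i < n].

Definition read_vec (R : realType) (d : nat) (rm : nat -> R) (a : nat) :
    'rV[R]_d :=
  \row_(j < d) rm (a + j)%N.

Definition write_vec (R : realType) (d : nat) (rm : nat -> R) (a : nat)
    (v : 'rV[R]_d) : nat -> R :=
  fun l => if (a <= l)%N then
             if insub (l - a)%N is Some j then v 0 j else rm l
           else rm l.

Definition config (R : realType) (d : nat) := (seq com * state R d)%type.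

(* One step against an owner who, after the replies [ys], gives out the function
   [g ys]. The first component of a configuration is the stack of the commands
   to be executed; a terminated or blocked configuration is a fixed point of
   [step]. [Flip] blocks on an exhausted tape, [Query] blocks on a second query
   to the same function, and [Answer] blocks before the first one. *)
Definition step (R : realType) (n d : nat)
    (g : seq 'rV[R]_d -> n.-tuple bool -> 'rV[R]_d) (c : config R d) :
    config R d :=
  let: (K, st) := c in
  let: State nm rm tp ak rs := st in
  match K with
  | [::] => c
  | Skip :: K' => (K', st)
  | NSet a e :: K' =>
      (K', State (upd nm (neval nm a) (neval nm e)) rm tp ak rs)
  | RSet a e :: K' =>
      (K', State nm (upd rm (neval nm a) (reval nm rm e)) tp ak rs)
  | Flip a :: K' =>
      if tp is b :: tp' then
        (K', State (upd nm (neval nm a) (nat_of_bool b)) rm tp' ak rs)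
      else c
  | Query a b :: K' =>
      if ak then c else
        let X := read_point n nm (neval nm a) in
        (K', State nm (write_vec rm (neval nm b) (g rs X)) tp true rs)
  | Answer a :: K' =>
      if ak then
        let Y := read_vec d rm (neval nm a) in
        (K', State nm rm tp false (rcons rs Y))
      else c
  | Seq c1 c2 :: K' => (c1 :: c2 :: K', st)
  | If b c1 c2 :: K' => ((if beval nm rm b then c1 else c2) :: K', st)
  | While b c1 :: K' =>
      if beval nm rm b then (c1 :: While b c1 :: K', st) else (K', st)
  end.

Definition init (R : realType) (d : nat) (p : com) (ns : seq nat) (rs : seq R)
    (s : seq bool) : config R d :=
  ([:: p], State (nth 0%N ns) (nth 0 rs) s false [::]).

(* [k] completed rounds, that is, with the rules of [step], one query to each of
   [k] successive functions, each followed by one reply. *)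
Definition completed (R : realType) (d k : nat) (c : config R d) : bool :=
  [&& nilp c.1, ~~ asked c.2 & size (replies c.2) == k].

(* The configuration after [t] steps of [p], which receives the parameters
   [n, k, d] and [eps, delta, gamma] in its first registers, facing the owner
   [O] with randomness [w] and using the random bits [s]. *)
Definition play (R : realType) (p : com) (n k d : nat) (eps delta gamma : R)
    (T : Type) (O : owner n d eps delta T) (t : nat) (w : T) (s : seq bool) :
    config R d :=
  iter t (step (fct O w)) (init d p [:: n; k; d] [:: eps; delta; gamma] s).

(* [max_(i < k) `|Y_i - mu_i| > eps'] *)
Definition fails (R : realType) (n k d : nat) (eps delta eps' : R) (T : Type)
    (O : owner n d eps delta T) (w : T) (ys : seq 'rV[R]_d) : Prop :=
  exists2 i, (i < k)%N & eps' < `|nth 0 ys i - center O w (take i ys)|.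

(* On parameters [n, k, d, eps, delta, gamma], the program [p] is a one-query
   (eps', delta')-steward for [k] adaptively chosen (eps, delta)-concentrated
   functions; it uses at most [m] random bits and runs in time at most [t]. The
   owner is adversarial, and its randomness, an arbitrary probability space, is
   independent of the [m] uniform bits of the steward. The probability of
   failure is defined, hence constrained, when the failure event is measurable,
   which for the product with a finite space is measurability of each section. *)
Definition one_query_steward (R : realType) (p : com) (n k d : nat)
    (eps delta gamma : R) (m t : nat) (eps' delta' : R) : Prop :=
  forall (disp : measure_display) (T : measurableType disp)
    (P : probability T R) (O : owner n d eps delta T),
    let run w (s : m.-tuple bool) := play p k gamma O t w s in
    let failure s := [set w | fails k eps' O w (replies (run w s).2)]%classic in
    (forall w s, completed k (run w s)) /\
    ((forall s, measurable (failure s)) ->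
     ((2 ^- m)%:E * \sum_(s : m.-tuple bool) P (failure s) <= delta'%:E)%E).

Definition log2 (R : realType) (x : R) : R := ln x / ln 2.

(* [log (1/x)], truncated at 0 for [x > 1], where an upper bound of the form
   [n + O(log (1/x))] would otherwise be negative for large [x]. *)
Definition log_inv (R : realType) (x : R) : R := Num.max 0 (log2 x^-1).

(* Main.v *)
(* The steward shifts the value [W = f_i(X_i)] by one of the [d + 1] multiples
   [0, ..., 2 eps d] of [2 eps] and rounds it to a multiple of [2 (d + 1) eps].
   Some shift puts every coordinate at distance [eps] from the boundary of its
   cell; then the reply is a function of [mu_i] and of the shift alone. So, as
   long as no value is far from its center, an owner is a decision tree that
   branches [d + 1] ways, plus one way for failure, at each point it is given.

   Such trees are fooled by a generator of Impagliazzo-Nisan-Wigderson type: the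
   seed of level [j + 1] is a seed of level [j] followed by instructions for a
   walk on an expander whose vertices are the seeds of level [j], and its points
   are those of the seed before and after the walk. There are at most
   [(d + 2)^(2^j)] outcomes for the first half of the points, so that a walk of
   length O(2^j log (d + 2) + log k + log (1 / gamma)) makes the two halves
   independent up to the error allowed, which gives the seed length.

   In one step of the walk, the first three bits of the string [z] are
   overwritten, and then [z_p] is replaced by [z_p + z_(p - h)] for all [p] of a
   given parity, with [h = 1] or [h = 3]. On the Walsh side the overwriting
   projects on the characters that do not involve the first three bits, and the
   four shears permute the characters. Among the four images of such a character
   of lowest index [m], two have a lower lowest index, and at most one has a
   higher one: a weighted Cauchy-Schwarz inequality yields a spectral gap.

   Successive steps of a walk consume the top bits of the same string, so the
   steward computes a point by shrinking a copy of its seed in place. *)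
Require Import Defs.
From mathcomp Require Import measurable_realfun.
From mathcomp Require Import zify ring lra.

Set Implicit Arguments.
Unset Strict Implicit.
Unset Printing Implicit Defensive.

Local Open Scope ring_scope.

(** * Averages over the cube and the Walsh transform *)

(** Strings of all lengths share the type [nat -> bool], the length being carried by the statements;
    seeds of successive levels then need no casts. *)
Definition agree (s : nat) (z z' : nat -> bool) := forall p, (p < s)%N -> z p = z' p.

Definition depends (V : Type) (s : nat) (F : (nat -> bool) -> V) :=
  forall z z', agree s z z' -> F z = F z'.

Lemma dependsW (V : Type) s t (F : (nat -> bool) -> V) :
  (s <= t)%N -> depends s F -> depends t F.
Proof. by move=> st dF z z' zz'; apply: dF => p ps; apply: zz'; exact: leq_trans st. Qed.

Section CubeSum.
Context {R : realType}.
Implicit Types (F f g A B : (nat -> bool) -> R) (z xi : nat -> bool).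

Definition csum (s : nat) F : R := \sum_(x : s.-tuple bool) F (nth false x).

Lemma csum0 F : csum 0 F = F (fun=> false).
Proof.
rewrite /csum (big_pred1 [tuple]) => [|x]; last by apply/esym/eqP; exact: tuple0.
by congr F; apply/funext => p; rewrite nth_nil.
Qed.

Lemma csumS s F :
  csum s.+1 F = csum s (fun z => F (upd z s false) + F (upd z s true)).
Proof.
rewrite /csum.
rewrite (reindex (fun p : bool * s.-tuple bool => [tuple of rcons p.2 p.1])) /=; last first.
  apply: onW_bij; exists (fun x : s.+1.-tuple bool =>
    (last false x, [tuple nth false x i | i < s])).
    move=> [b x] /=; rewrite last_rcons; congr (_, _).
    apply: eq_from_tnth => i; rewrite tnth_mktuple nth_rcons size_tuple ltn_ord.
    by rewrite (tnth_nth false).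
  move=> x /=; apply: val_inj => /=; apply: (@eq_from_nth _ false).
    by rewrite size_rcons size_map size_enum_ord size_tuple.
  rewrite size_rcons size_map size_enum_ord => i; rewrite ltnS => ii.
  rewrite nth_rcons size_map size_enum_ord; case: ltnP => [il|il].
    by rewrite (nth_map (Ordinal il)) ?size_enum_ord// nth_enum_ord.
  have -> : i = s by apply/eqP; rewrite eqn_leq ii.
  by rewrite eqxx -nth_last size_tuple.
rewrite -(pair_bigA _ (fun b (x : s.-tuple bool) => F (nth false (rcons x b)))) /=.
rewrite exchange_big/=; apply: eq_bigr => x _.
rewrite big_bool /= addrC.
by congr (F _ + F _); apply/funext => p; rewrite nth_rcons /upd size_tuple; 
  case: (ltngtP p s) => // ps; rewrite nth_default // size_tuple ltnW.
Qed.

Lemma eq_csum s F f : (forall z, F z = f z) -> csum s F = csum s f.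
Proof. by move=> e; apply: eq_bigr. Qed.

Lemma le_csum s F f : (forall z, F z <= f z) -> csum s F <= csum s f.
Proof. by move=> e; apply: ler_sum. Qed.

Lemma csum_ge0 s F : (forall z, 0 <= F z) -> 0 <= csum s F.
Proof. by move=> F0; apply: sumr_ge0. Qed.

Lemma csumD s F f : csum s (fun z => F z + f z) = csum s F + csum s f.
Proof. exact: big_split. Qed.

Lemma csumB s F f : csum s (fun z => F z - f z) = csum s F - csum s f.
Proof. exact: sumrB. Qed.

Lemma csumZ s a F : csum s (fun z => a * F z) = a * csum s F.
Proof. by rewrite /csum mulr_sumr. Qed.

Lemma csum_sum (I : finType) s (F : I -> (nat -> bool) -> R) :
  csum s (fun z => \sum_i F i z) = \sum_i csum s (F i).
Proof. exact: exchange_big. Qed.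

Lemma csum_cst s (a : R) : csum s (fun=> a) = 2 ^+ s * a.
Proof.
by rewrite /csum sumr_const card_tuple card_bool -natrX mulr_natl.
Qed.

Lemma csum_involution s (phi : (nat -> bool) -> nat -> bool) F :
  (forall z z', agree s z z' -> agree s (phi z) (phi z')) ->
  (forall z, agree s (phi (phi z)) z) ->
  depends s F -> csum s (fun z => F (phi z)) = csum s F.
Proof.
move=> loc inv dF.
pose phi' (x : s.-tuple bool) := [tuple phi (nth false x) i | i < s].
have phi'E x : agree s (nth false (phi' x)) (phi (nth false x)).
  move=> p ps; rewrite -(tnth_nth false (phi' x) (Ordinal ps)).
  by rewrite tnth_mktuple.
have invK : involutive phi'.
  move=> x; apply: eq_from_tnth => i; rewrite tnth_mktuple.
  rewrite (loc _ _ (phi'E x)) ?ltn_ord// inv ?ltn_ord//.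
  by rewrite -tnth_nth.
rewrite /csum [RHS](reindex_inj (inv_inj invK)) /=.
by apply: eq_bigr => x _; apply: dF => p ps; rewrite phi'E.
Qed.

Definition forget (i : nat) F z : R := (F (upd z i false) + F (upd z i true)) / 2.

Lemma upd_agree s (V : Type) (z z' : nat -> V) i b :
  (forall p, (p < s)%N -> z p = z' p) ->
  forall p, (p < s)%N -> upd z i b p = upd z' i b p.
Proof. by move=> e p ps; rewrite /upd e. Qed.

Lemma depends_forget s i F : depends s F -> depends s (forget i F).
Proof.
move=> dF z z' zz'; rewrite /forget.
by congr ((_ + _) / 2); apply: dF; apply: upd_agree.
Qed.

Lemma csum_forget s i F : depends s F -> csum s (forget i F) = csum s F.
Proof.
move=> dF.
have e : csum s (fun z => F (upd z i (~~ z i))) = csum s F.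
  apply: (@csum_involution s (fun z => upd z i (~~ z i))) => //.
    by move=> z z' zz' p ps; rewrite /upd; case: eqP => [<-|_]; rewrite zz'.
  by move=> z p ps; rewrite /upd eqxx; case: eqP => [->|//]; rewrite negbK.
have -> : csum s (forget i F) =
    csum s (fun z => 2^-1 * (F z + F (upd z i (~~ z i)))).
  apply: eq_csum => z; rewrite /forget mulrC; congr (_ * _).
  have ez : upd z i (z i) = z by apply/funext => p; rewrite /upd; case: eqP => // ->.
  rewrite -{3}ez; case: (z i) => //=; first by rewrite addrC.
by rewrite csumZ csumD e; field.
Qed.

(** Averaging over one bit is an orthogonal projection: both sides equal the sum of the product of
    the two averaged functions. *)
Lemma csum_forget_mul s i A B : depends s A -> depends s B ->
  csum s (fun z => forget i A z * B z) = csum s (fun z => A z * forget i B z).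
Proof.
have H A' B' : depends s A' -> depends s B' ->
  csum s (fun z => forget i A' z * B' z) =
  csum s (fun z => forget i A' z * forget i B' z).
  move=> dA dB; rewrite -[LHS](@csum_forget s i); last first.
    by move=> z z' zz'; rewrite (depends_forget i dA zz') (dB _ _ zz').
  apply: eq_csum => z; rewrite /forget.
  have e b c : upd (upd z i b) i c = upd z i c.
    by apply/funext => p; rewrite /upd; case: eqP.
  by rewrite !e; ring.
move=> dA dB; rewrite H//.
transitivity (csum s (fun z => forget i B z * A z)); last first.
  by apply: eq_csum => z; rewrite mulrC.
by rewrite [RHS]H//; apply: eq_csum => z; rewrite mulrC.
Qed.

Definition chi (s : nat) xi z : R := \prod_(0 <= p < s) (-1) ^+ (xi p && z p).

Definition walsh (s : nat) f xi : R := csum s (fun z => f z * chi s xi z).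

Lemma depends_chi s xi : depends s (chi s xi).
Proof.
move=> z z' zz'; rewrite /chi !big_mkord; apply: eq_bigr => p _.
by rewrite zz'.
Qed.

Lemma chi_agree s xi xi' z : agree s xi xi' -> chi s xi z = chi s xi' z.
Proof.
move=> zz'; rewrite /chi !big_mkord; apply: eq_bigr => p _.
by rewrite zz'.
Qed.

Lemma depends_walsh s f : depends s (walsh s f).
Proof. by move=> x x' xx'; apply: eq_csum => z; rewrite (chi_agree _ xx'). Qed.

(** Induction on the top bit: the coefficients at its two values are the sum and the difference of
    those of the half-cubes, and [(a + b)(c + d) + (a - b)(c - d) = 2 (a c + b d)]. *)
Lemma parseval s f g :
  csum s (fun xi => walsh s f xi * walsh s g xi) = 2 ^+ s * csum s (fun z => f z * g z).
Proof.
elim: s f g => [|s IH] f g.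
  by rewrite !csum0 /walsh !csum0 /chi !big_geq// !mulr1 mul1r.
rewrite !csumS.
have e c xi h : walsh s.+1 h (upd xi s c) =
    walsh s (fun z => h (upd z s false)) xi +
    (-1) ^+ c * walsh s (fun z => h (upd z s true)) xi.
  rewrite /walsh csumS -csumZ -csumD; apply: eq_csum => z.
  rewrite /chi !big_nat_recr//= {2 4}/upd eqxx.
  have e b : \prod_(0 <= i < s) (-1) ^+ (upd xi s c i && upd z s b i) =
      \prod_(0 <= i < s) (-1) ^+ (xi i && z i) :> R.
    rewrite !big_mkord; apply: eq_bigr => i _.
    by rewrite /upd !ltn_eqF.
  rewrite !e /upd eqxx /=; case: c {e} => /=; rewrite ?andbF ?andbT /=; ring.
rewrite (@eq_csum s _ (fun xi => 2 * (
    walsh s (fun z => f (upd z s false)) xi * walsh s (fun z => g (upd z s false)) xi +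
    walsh s (fun z => f (upd z s true)) xi * walsh s (fun z => g (upd z s true)) xi))).
  by rewrite csumZ !csumD !IH -mulrDr exprS mulrA.
by move=> xi; rewrite !e /= expr0 expr1 !mul1r; ring.
Qed.

Lemma walsh_zero s f : walsh s f (fun=> false) = csum s f.
Proof.
apply: eq_csum => z; rewrite /chi big1 ?mulr1// => i _.
Qed.

(** By self-adjointness the average moves onto the character, which it kills or fixes according to
    whether bit [i] is involved. *)
Lemma walsh_forget s i f xi : depends s f ->
  walsh s (forget i f) xi = if (i < s)%N && xi i then 0 else walsh s f xi.
Proof.
move=> df; rewrite /walsh csum_forget_mul//; last exact: depends_chi.
have -> : forget i (chi s xi) = if (i < s)%N && xi i then (fun=> 0) else chi s xi.
  apply/funext => z; rewrite /forget.
  have [si|si] /= := leqP s i.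
    have e b : chi s xi (upd z i b) = chi s xi z.
      by apply: depends_chi => p ps; rewrite /upd ltn_eqF// (leq_trans ps).
    by rewrite !e; field.
  have c y : chi s xi y = (-1) ^+ (xi i && y i) *
      \prod_(j < s | j != Ordinal si) (-1) ^+ (xi j && y j).
    by rewrite /chi big_mkord (bigD1 (Ordinal si)).
  have e b : \prod_(j < s | j != Ordinal si) (-1) ^+ (xi j && upd z i b j) =
      \prod_(j < s | j != Ordinal si) (-1) ^+ (xi j && z j) :> R.
    apply: eq_bigr => j /negbTE ji; rewrite /upd; case: eqP => // jE.
    by rewrite -(inj_eq val_inj)/= jE eqxx in ji.
  rewrite !c !e /upd eqxx andbF andbT; case: (xi i) c => c /=.
    by rewrite expr0 expr1 mul1r mulN1r subrr mul0r.
  by rewrite c expr0 mul1r; field.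
by case: ifP => _ //; rewrite (@eq_csum s _ (fun=> 0)) ?csum_cst ?mulr0// => z; rewrite mulr0.
Qed.

End CubeSum.

(** * A constant-degree expander on bit strings *)

Definition hop (b : bool) : nat := if b then 3 else 1.

(** Hops are odd, so the bits added sit at positions of parity [o] and the bits changed at the other
    parity. The map is thus an involution and can be performed in place. *)
Definition shear (o b : bool) (z : nat -> bool) : nat -> bool := fun p =>
  z p (+) [&& (hop b <= p)%N, odd (p - hop b) == o & z (p - hop b)%N].

(** The transpose of [shear] over the two-element field, acting on frequencies; see [chi_shear]. *)
Definition dshear (s : nat) (o b : bool) (xi : nat -> bool) : nat -> bool := fun q =>
  xi q (+) [&& odd q == o, (q + hop b < s)%N & xi (q + hop b)%N].

Lemma odd_hop b : odd (hop b). Proof. by case: b. Qed.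

Lemma shear_local s o b z z' : agree s z z' -> agree s (shear o b z) (shear o b z').
Proof.
move=> zz' p ps; rewrite /shear zz'//; case: leqP => //= _.
by rewrite zz'// (leq_ltn_trans _ ps)// leq_subr.
Qed.

Lemma shearK o b z : shear o b (shear o b z) = z.
Proof.
apply/funext => p; rewrite /shear; set h := hop b.
case: (leqP h p) => //= hp; last by rewrite !addbF.
case: eqP => [op|_] /=; last by rewrite !addbF.
rewrite -addbA; case: (leqP h (p - h)) => [hp'|]; last by rewrite addbF addbb addbF.
by rewrite oddB// op odd_hop; case: (o); rewrite /= ?andbF addbF addbb addbF.
Qed.

Lemma dshear_local s o b x x' : agree s x x' -> agree s (dshear s o b x) (dshear s o b x').
Proof.
by move=> xx' p ps; rewrite /dshear xx'//; case: ltnP => [l|_]; [rewrite xx'|rewrite !andbF].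
Qed.

Lemma dshearK s o b xi : dshear s o b (dshear s o b xi) = xi.
Proof.
apply/funext => p; rewrite /dshear; set h := hop b.
case: eqP => [op|_] /=; last by rewrite !addbF.
rewrite oddD op odd_hop; case: (p + h < s)%N => /=; last by rewrite !addbF.
by case: (o); rewrite /= addbF -addbA addbb addbF.
Qed.

(** * The spectral gap of one step, on the Walsh side *)

Section Gap.
Context {R : realType}.
Implicit Types (F f g A B : (nat -> bool) -> R) (z xi : nat -> bool).

Lemma prod_shift (V : comPzRingType) s h (G : nat -> nat -> V) :
  \prod_(0 <= p < s) (if (h <= p)%N then G (p - h)%N p else 1) =
  \prod_(0 <= q < s) (if (q + h < s)%N then G q (q + h)%N else 1).
Proof.
have [hs|sh] := leqP h s; last first.
  by rewrite !big_nat !big1// => i /andP[_ si]; case: ifP => //; lia.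
rewrite (@big_cat_nat _ _ _ h)//= big_nat big1 ?mul1r; last first.
  by move=> i /andP[_ ih]; rewrite leqNgt ih.
rewrite [RHS](@big_cat_nat _ _ _ (s - h)%N)//= ?leq_subr//.
rewrite [X in _ = _ * X]big_nat [X in _ = _ * X]big1 ?mulr1; last first.
  by move=> i /andP[ih si]; case: ifP => //; lia.
rewrite -{1}[h]add0n big_addn !big_nat; apply: eq_bigr => i /andP[_ ih].
by rewrite leq_addl addnK; case: ifP => //; lia.
Qed.

Lemma chi_shear s o b xi z : chi s xi (shear o b z) = chi s (dshear s o b xi) z :> R.
Proof.
rewrite /chi /shear /dshear.
under eq_bigr => p _ do rewrite andb_addr signr_addb.
under [RHS]eq_bigr => p _ do rewrite andb_addl signr_addb.
rewrite !big_split; congr (_ * _).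
have := @prod_shift R s (hop b) (fun q p => (-1) ^+ [&& odd q == o, xi p & z q]).
under eq_bigr => p _.
  rewrite (_ : (if _ then _ else _) =
   (-1) ^+ (xi p && [&& (hop b <= p)%N, odd (p - hop b) == o & z (p - hop b)%N])).
    over.
  by case: leqP => //= _; rewrite ?andbF// ; congr (_ ^+ nat_of_bool _); rewrite andbCA.
move=> ->; apply: eq_bigr => q _.
case: ltnP => //= _; rewrite ?andbF//; congr (_ ^+ nat_of_bool _).
by rewrite andbA.
Qed.

Lemma csum_shear s o b F : depends s F -> csum s (fun z => F (shear o b z)) = csum s F.
Proof.
apply: csum_involution => [z z'|z]; first exact: shear_local.
by rewrite shearK.
Qed.

Lemma csum_dshear s o b F : depends s F ->
  csum s (fun xi => F (dshear s o b xi)) = csum s F.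
Proof.
apply: csum_involution => [z z'|z]; first exact: dshear_local.
by rewrite dshearK.
Qed.

Lemma depends_shear s o b F : depends s F -> depends s (fun z => F (shear o b z)).
Proof. by move=> dF z z' zz'; apply: dF; exact: shear_local. Qed.

Lemma walsh_shear s o b f xi : depends s f ->
  walsh s (fun z => f (shear o b z)) xi = walsh s f (dshear s o b xi).
Proof.
move=> df; rewrite /walsh -[LHS](csum_shear o b); last first.
  by move=> z z' zz'; rewrite (depends_shear o b df zz') (depends_chi _ zz').
by apply: eq_csum => z; rewrite shearK chi_shear.
Qed.

Definition forget3 F := forget 0 (forget 1 (forget 2 F)).

Definition low_free (s : nat) xi := [forall i : 'I_3, ~~ ((i < s)%N && xi i)].

Lemma walsh_forget3 s f xi : depends s f ->
  walsh s (forget3 f) xi = if low_free s xi then walsh s f xi else 0.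
Proof.
move=> df; rewrite /forget3 !walsh_forget//; do ?apply: depends_forget => //.
case: ifP => [x0|x0]; last case: ifP => [x1|x1]; last case: ifP => [x2|x2].
- by case: ifP => // /forallP/(_ (inord 0)); rewrite inordK// x0.
- by case: ifP => // /forallP/(_ (inord 1)); rewrite inordK// x1.
- by case: ifP => // /forallP/(_ (inord 2)); rewrite inordK// x2.
- case: ifP => // /negP[]; apply/forallP => -[[|[|[|//]]] /= _]; by rewrite ?x0 ?x1 ?x2.
Qed.

Lemma depends_forget3 s f : depends s f -> depends s (forget3 f).
Proof. by move=> df; do 3 apply: depends_forget. Qed.

Lemma depends_low_free s : depends s (low_free s).
Proof.
move=> z z' zz'; apply/eq_forallb => i; case: ltnP => //= si.
by rewrite zz'.
Qed.

(** The lowest index in the support of [xi]; the value [s] marks the zero frequency. *)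
Definition lead (s : nat) xi : nat := find xi (iota 0 s).

Lemma lead_le s xi : (lead s xi <= s)%N.
Proof. by rewrite -[leqRHS](size_iota 0) find_size. Qed.

Lemma leadP s xi : (lead s xi < s)%N -> xi (lead s xi).
Proof.
move=> l; have := @nth_find _ 0%N xi (iota 0 s).
by rewrite has_find size_iota => /(_ l); rewrite nth_iota.
Qed.

Lemma lead_min s xi q : (q < lead s xi)%N -> xi q = false.
Proof.
move=> l; have := before_find 0%N l.
by rewrite nth_iota// (leq_trans l)// lead_le.
Qed.

Lemma lead_leq s xi q : (q < s)%N -> xi q -> (lead s xi <= q)%N.
Proof. by move=> qs xq; rewrite leqNgt; apply/negP => /lead_min; rewrite xq. Qed.

Lemma depends_lead s : depends s (lead s).
Proof.
move=> z z' zz'; apply: eq_in_find => p; rewrite mem_iota => /andP[_ ps].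
exact: zz'.
Qed.

(* The ratio [2 / 3] makes the worst case [2 r + 1 + 1 / r] of [weight_sum]
   smaller than 4. *)
Definition weight (m m' : nat) : R :=
  if (m' < m)%N then 2 / 3 else if m' == m then 1 else 3 / 2.

(** The pairs that can contribute to the form: nonzero, with an end that survives the overwriting.
    Between a frequency and its image under a shear this is symmetric, so sums can be taken from
    either end. *)
Definition live s xi xi' := (lead s xi < s)%N && (low_free s xi || low_free s xi').

Lemma low_freeF s xi q : (q < 3)%N -> (q < s)%N -> xi q -> low_free s xi = false.
Proof.
move=> q3 qs xq; apply/negbTE/negP => /forallP/(_ (Ordinal q3)) /=.
by rewrite qs xq.
Qed.

(* A shear that does not touch the parity of the lead creates a smaller lead;
   of the other two, at most one can raise the lead. *)
Lemma weight_sum s xi :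
  \sum_(ob : bool * bool) (if live s xi (dshear s ob.1 ob.2 xi)
     then weight (lead s xi) (lead s (dshear s ob.1 ob.2 xi)) else 0) <= 23 / 6.
Proof.
pose m := lead s xi.
pose f (o b : bool) := if live s xi (dshear s o b xi)
  then weight m (lead s (dshear s o b xi)) else 0.
rewrite -[leLHS]/(\sum_(ob : bool * bool) f ob.1 ob.2) -(pair_bigA _ f) /=.
have [ms|sm] := ltnP m s; last first.
  rewrite big1 => [|o _]; last first.
    by rewrite big1// => b _; rewrite /f /live ltnNge sm.
  lra.
have xm : xi m by exact: leadP.
have fle o b : f o b <= 3 / 2.
  by rewrite /f /weight; do ?case: ifP => _; lra.
(* The bit at [m] is added at [m - hop b], where [xi] vanishes, so the lead drops. If [m < hop b],
   then [m < 3] and bit [m] is present at both ends, so the pair is not live. *)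
have other b : f (~~ odd m) b <= 2 / 3.
  rewrite /f; case: ifP => [lv|]; last by move=> _; lra.
  have [hm|mh] := leqP (hop b) m.
    have -> : weight m (lead s (dshear s (~~ odd m) b xi)) = 2 / 3; last by lra.
    rewrite /weight; case: ltnP => //.
    have : (lead s (dshear s (~~ odd m) b xi) <= m - hop b)%N.
      apply: lead_leq; first by rewrite (leq_ltn_trans _ ms)// leq_subr.
      rewrite /dshear oddB// odd_hop addbT eqxx subnK// ms xm /=.
      rewrite (@lead_min s)// -/m; move: (odd_hop b); lia.
    move: (odd_hop b); lia.
  have m3 : (m < 3)%N by move: mh; rewrite /hop; case: b {lv}; lia.
  move: lv; rewrite /live (low_freeF m3 ms xm) (low_freeF m3 ms) ?andbF//.
  by rewrite /dshear xm; case: (odd m).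
have same : f (odd m) false + f (odd m) true <= 1 + 3 / 2.
  suff : f (odd m) false <= 1 \/ f (odd m) true <= 1.
    by move: (fle (odd m) false) (fle (odd m) true); lra.
  have inc b : f (odd m) b <= 1 \/
      live s xi (dshear s (odd m) b xi) /\ (m < lead s (dshear s (odd m) b xi))%N.
    rewrite /f; case: ifP => lv; last by left; lra.
    rewrite /weight; case: ltngtP => l; [by left; lra|by right|by left; lra].
  case: (inc false) => [|[_ l1]]; first by left.
  case: (inc true) => [|[lv l3]]; first by right.
  (* If hop 1 raises the lead, [m.+1] is in the support, and hop 3 carries it down to [m - 2]. For
     [m < 2], bit [m] of [xi] and bit [m.+1] of its image are among the first three, so the pair is
     not live. *)
  exfalso.
  have /andP[m1s xm1] : (m.+1 < s)%N && xi m.+1.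
    by have := lead_min l1; rewrite /dshear xm eqxx/= addn1 => /negbFE.
  have [m2|m2] := leqP 2 m.
    have : (lead s (dshear s (odd m) true xi) <= m - 2)%N.
      apply: lead_leq; first by lia.
      rewrite /dshear oddB// addbF eqxx /= (@lead_min s xi)//=; last by rewrite -/m; lia.
      by rewrite (_ : m - 2 + 3 = m.+1)%N ?m1s//; lia.
    by lia.
  have m3 : (m < 3)%N by lia.
  move: lv; rewrite /live (low_freeF m3 ms xm) (@low_freeF s _ m.+1) ?andbF//.
  by rewrite /dshear xm1 /=; case: (odd m).
(* [2 / 3 + 2 / 3 + 1 + 3 / 2 = 23 / 6]. *)
rewrite !big_bool; move: (other false) (other true) same.
by case: (odd m) => /=; lra.
Qed.

Lemma weight_inv m m' : weight m m' * weight m' m = 1.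
Proof. by rewrite /weight; case: ltngtP => //= _; lra. Qed.

Lemma weight_gt0 m m' : 0 < weight m m'.
Proof. by rewrite /weight; do ?case: ifP => _; lra. Qed.

(* The adjoint of the average over one step of the walk, see [csum_mix]. *)
Definition qstar A z : R :=
  (\sum_(ob : bool * bool) forget3 A (shear ob.1 ob.2 z)) / 4.

Lemma depends_qstar s A : depends s A -> depends s (qstar A).
Proof.
move=> dA z z' zz'; congr (_ / _); apply: eq_bigr => ob _.
exact: (depends_shear _ _ (depends_forget3 dA)).
Qed.

Lemma lead_dshear s o b xi : (lead s (dshear s o b xi) < s)%N = (lead s xi < s)%N.
Proof.
have H x : (lead s x < s)%N -> (lead s (dshear s o b x) < s)%N.
  move=> l; rewrite ltnNge; apply/negP => sl.
  have z p : (p < s)%N -> dshear s o b x p = false.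
    by move=> ps; apply: (@lead_min s); exact: leq_trans sl.
  have : dshear s o b (dshear s o b x) (lead s x) by rewrite dshearK leadP.
  by rewrite {1}/dshear z//=; case: (odd _ == o) => //=; case: ltnP => //= l'; rewrite z.
by apply/idP/idP; [move=> /H; rewrite dshearK|exact: H].
Qed.

Lemma live_dshear s o b xi : live s (dshear s o b xi) xi = live s xi (dshear s o b xi).
Proof. by rewrite /live lead_dshear orbC. Qed.

(** Splitting the product along each edge with reciprocal weights charges at most [23 / 6] to either
    end, by [weight_sum]; the average over four shears turns this into [23 / 24]. *)
Lemma qstar_form s A B : depends s A -> depends s B -> csum s A = 0 ->
  2 * csum s (fun z => qstar A z * B z) <=
  23 / 24 * (csum s (fun z => A z * A z) + csum s (fun z => B z * B z)).
Proof.
move=> dA dB A0.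
pose a := walsh s A; pose b := walsh s B.
pose g xi := if low_free s xi then a xi else 0.
have da : depends s a by exact: depends_walsh.
have db : depends s b by exact: depends_walsh.
have dg : depends s g.
  by move=> x x' xx'; rewrite /g (depends_low_free xx') (da _ _ xx').
have wq xi : walsh s (qstar A) xi =
    (\sum_(ob : bool * bool) g (dshear s ob.1 ob.2 xi)) / 4.
  rewrite /walsh /qstar.
  transitivity (csum s (fun z => 4^-1 *
      \sum_(ob : bool * bool) forget3 A (shear ob.1 ob.2 z) * chi s xi z)).
    by apply: eq_csum => z; rewrite mulrAC mulrC mulr_suml.
  rewrite csumZ csum_sum mulrC; congr (_ / _); apply: eq_bigr => ob _.
  rewrite -[LHS]/(walsh s _ xi) walsh_shear; last exact: depends_forget3.
  by rewrite walsh_forget3.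
have step xi : 2 * ((\sum_(ob : bool * bool) g (dshear s ob.1 ob.2 xi)) * b xi) <=
    \sum_(ob : bool * bool) (
      (if live s xi (dshear s ob.1 ob.2 xi)
        then weight (lead s xi) (lead s (dshear s ob.1 ob.2 xi)) else 0)
        * (b xi * b xi) +
      (if live s (dshear s ob.1 ob.2 xi) xi
        then weight (lead s (dshear s ob.1 ob.2 xi)) (lead s xi) else 0)
        * (g (dshear s ob.1 ob.2 xi) * g (dshear s ob.1 ob.2 xi))).
  rewrite mulr_suml mulr_sumr; apply: ler_sum => -[p c] _ /=.
  rewrite live_dshear; set y := dshear s p c xi.
  case: ifP => [lv|/negbT nlv].
    set w := weight _ _; set w' := weight _ _.
    have ww : w * w' = 1 by exact: weight_inv.
    have w0 : 0 < w' by exact: weight_gt0.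
    rewrite -subr_ge0 (_ : _ - _ = w' * (w * b xi - g y) ^+ 2).
      by rewrite mulr_ge0 ?sqr_ge0 ?ltW.
    transitivity (w * (w * w') * (b xi * b xi) + w' * (g y * g y)
       - 2 * (w * w') * (g y * b xi)); last by ring.
    by rewrite ww; ring.
  (* If the pair is not live, either [y] meets the first three bits or [y] is the zero frequency,
     whose coefficient is the vanishing sum of [A]. *)
  suff -> : g y = 0 by rewrite !(mul0r, mulr0) addr0.
  rewrite /g; case: ifP => // ly.
  move: nlv; rewrite /live ly orbT andbT -(lead_dshear s p c) -/y -leqNgt => sl.
  rewrite /a (@depends_walsh _ s A y (fun=> false)) ?walsh_zero//.
  by move=> i si; rewrite (@lead_min s)//; exact: leq_trans sl.
have dl x x' o c : agree s x x' ->
   lead s x = lead s x' /\ lead s (dshear s o c x) = lead s (dshear s o c x') /\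
   live s x (dshear s o c x) = live s x' (dshear s o c x').
  move=> xx'; have := dshear_local o c xx' => yy'.
  by rewrite /live !(depends_lead xx') !(depends_lead yy') !(depends_low_free xx')
    !(depends_low_free yy').
have main : 2 * csum s (fun xi => (\sum_(ob : bool * bool) g (dshear s ob.1 ob.2 xi)) * b xi)
    <= 23 / 6 * (csum s (fun xi => b xi * b xi) + csum s (fun xi => g xi * g xi)).
  rewrite -csumZ; apply: (le_trans (le_csum s step)).
  rewrite csum_sum; under eq_bigr => ob _ do rewrite csumD.
  rewrite big_split /= mulrDr; apply: lerD.
    rewrite -csum_sum -csumZ; apply: le_csum => xi.
    rewrite -mulr_suml ler_wpM2r ?weight_sum//.
    by rewrite -expr2 sqr_ge0.
  rewrite (eq_bigr (fun ob : bool * bool => csum s (fun xi =>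
     (if live s xi (dshear s ob.1 ob.2 xi)
        then weight (lead s xi) (lead s (dshear s ob.1 ob.2 xi)) else 0)
     * (g xi * g xi)))).
    rewrite -csum_sum -csumZ; apply: le_csum => xi.
    rewrite -mulr_suml ler_wpM2r ?weight_sum//.
    by rewrite -expr2 sqr_ge0.
  move=> [p c] _ /=; rewrite -[RHS](csum_dshear p c).
    by apply: eq_csum => xi; rewrite dshearK.
  by move=> x x' xx'; have [-> [-> ->]] := dl _ _ p c xx'; rewrite (dg _ _ xx').
have gle : csum s (fun xi => g xi * g xi) <= csum s (fun xi => a xi * a xi).
  apply: le_csum => xi; rewrite /g; case: ifP => // _.
  by rewrite mul0r -expr2 sqr_ge0.
have e : 2 ^+ s * csum s (fun z => qstar A z * B z) =
    csum s (fun xi => (\sum_(ob : bool * bool) g (dshear s ob.1 ob.2 xi)) * b xi) / 4.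
  rewrite -parseval [RHS]mulrC -csumZ; apply: eq_csum => xi.
  by rewrite wq /b; ring.
rewrite -(ler_pM2l (_ : 0 < 2 ^+ s)) ?exprn_gt0//.
rewrite mulrCA e [leRHS]mulrCA mulrDr -!parseval -/a -/b.
by move: main gle; lra.
Qed.

Lemma csum_qstar s A : depends s A -> csum s (qstar A) = csum s A.
Proof.
move=> dA; rewrite /qstar.
transitivity (csum s (fun z => 4^-1 *
      \sum_(ob : bool * bool) forget3 A (shear ob.1 ob.2 z))).
  by apply: eq_csum => z; rewrite mulrC.
rewrite csumZ csum_sum; under eq_bigr => ob _.
  rewrite (@csum_shear s ob.1 ob.2 (forget3 A)); last exact: depends_forget3.
  rewrite /forget3 !csum_forget//; do ?apply: depends_forget => //.
  over.
rewrite sumr_const card_prod card_bool (_ : (2 * 2)%N = 4%N)//.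
by rewrite -[csum s A *+ _]mulr_natl mulrA mulVf ?mul1r ?pnatr_eq0.
Qed.

(** The form bound is applied to [B := 24 / 23 * qstar A]: half of its left side then absorbs the
    second term on the right. *)
Lemma qstar_norm s A : depends s A -> csum s A = 0 ->
  csum s (fun z => qstar A z * qstar A z) <=
  (23 / 24) ^+ 2 * csum s (fun z => A z * A z).
Proof.
move=> dA A0.
have dQ : depends s (fun z => 24 / 23 * qstar A z).
  by move=> z z' zz'; rewrite (depends_qstar dA zz').
have := qstar_form dA dQ A0.
rewrite (@eq_csum _ s _ (fun z => 24 / 23 * (qstar A z * qstar A z))) => [|z]; last by ring.
rewrite (@eq_csum _ s (fun z => 24 / 23 * qstar A z * (24 / 23 * qstar A z))
   (fun z => (24 / 23) ^+ 2 * (qstar A z * qstar A z))) => [|z]; last by ring.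
rewrite !csumZ.
set X := csum s _; set Y := csum s _; lra.
Qed.

End Gap.

(** * Walks driven by the top bits of a string *)

Definition refresh (s : nat) (z : nat -> bool) : nat -> bool := fun q =>
  if (q < 3)%N then z (s + q)%N else z q.

(** A step consumes the five bits from position [s] on: three overwrite the low bits and two select
    the shear. *)
Definition mix (s : nat) (z : nat -> bool) : nat -> bool :=
  shear (z (s + 3)%N) (z (s + 4)%N) (refresh s z).

(** The topmost instructions are consumed first, and each step also transforms the instructions
    still to come, which lie lower in the string. *)
Fixpoint walk (s e : nat) (z : nat -> bool) : nat -> bool :=
  if e is e'.+1 then walk s e' (mix (s + 5 * e') z) else z.

Section Mixing.
Context {R : realType}.
Implicit Types (F f g A B : (nat -> bool) -> R) (z xi : nat -> bool).

Lemma csum_top5 t F : csum (t + 5) F = \sum_(ob : bool * bool) csum t (fun z =>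
  \sum_(c0 : bool) \sum_(c1 : bool) \sum_(c2 : bool)
   F (upd (upd (upd (upd (upd z (t + 0) c0) (t + 1) c1) (t + 2) c2) (t + 3) ob.1) (t + 4) ob.2)).
Proof.
rewrite -csum_sum !addnS addn0 !csumS; apply: eq_csum => z.
rewrite -(pair_bigA _ (fun p c => \sum_(c0 : bool) \sum_(c1 : bool) \sum_(c2 : bool)
   F (upd (upd (upd (upd (upd z t c0) t.+1 c1) t.+2 c2) t.+3 p) t.+4 c))) /=.
by rewrite !big_bool /=; ring.
Qed.

(** Time reversal: with the end of the step fixed, [A] is averaged over the possible starts. Of the
    factor 32, 8 counts the values of the fresh bits and 4 cancels the normalization of [qstar]. *)
Lemma csum_mix t A B : depends t A -> depends t B ->
  csum (t + 5) (fun z => A z * B (mix t z)) =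
  32 * csum t (fun z => qstar A z * B z).
Proof.
move=> dA dB; rewrite csum_top5.
transitivity (\sum_(ob : bool * bool)
    8 * csum t (fun z => forget3 A (shear ob.1 ob.2 z) * B z)).
  apply: eq_bigr => -[p c] _ /=.
  pose B' z := B (shear p c z).
  have dB' : depends t B' by exact: depends_shear.
  transitivity (8 * csum t (fun z => forget3 A z * B' z)); last first.
    rewrite -(csum_shear p c).
      by congr (_ * _); apply: eq_csum => z; rewrite /B' shearK.
    move=> z z' zz'; rewrite (dB' _ _ zz'); congr (_ * _).
    exact: depends_forget3 zz'.
  rewrite /forget3 !csum_forget_mul//; do ?apply: depends_forget => //.
  rewrite -csumZ; apply: eq_csum => z.
  have -> : forget 2 (forget 1 (forget 0 B')) z = 8^-1 *
      \sum_(c0 : bool) \sum_(c1 : bool) \sum_(c2 : bool)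
      B' (upd (upd (upd z 0 c0) 1 c1) 2 c2).
    have sw (i j : nat) b b' : i != j -> upd (upd z j b) i b' = upd (upd z i b') j b.
      move=> ij; apply/funext => q; rewrite /upd.
      by case: (q =P i) => // ->; rewrite (negbTE ij).
    have sw3 b0 b1 b2 : upd (upd (upd z 2 b2) 1 b1) 0 b0 =
        upd (upd (upd z 0 b0) 1 b1) 2 b2.
      apply/funext => q; rewrite /upd.
      by case: (q =P 2) => [->|] //; case: (q =P 1) => [->|].
    by rewrite /forget !big_bool /= !sw3; field.
  rewrite mulrCA mulVKf ?pnatr_eq0// mulr_sumr; apply: eq_bigr => c0 _.
  rewrite mulr_sumr; apply: eq_bigr => c1 _.
  rewrite mulr_sumr; apply: eq_bigr => c2 _.
  congr (_ * _).
    by apply: dA => q qt; rewrite /upd !ltn_eqF//; lia.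
  rewrite /B' /mix.
  rewrite {1 2}/upd !eqn_add2l /= {1}/upd eqxx.
  apply: dB; apply: shear_local => q qt; rewrite /refresh.
  case: q qt => [|[|[|q]]] qt; rewrite /= /upd ?eqn_add2l//=.
  by rewrite !(ltn_eqF (leq_trans qt (leq_addr _ _))).
rewrite -mulr_sumr -csum_sum -[in RHS]csumZ -csumZ; apply: eq_csum => z.
by rewrite /qstar -mulr_suml; field.
Qed.

Lemma mix_local s z z' : agree (s + 5) z z' -> agree s (mix s z) (mix s z').
Proof.
move=> zz'; rewrite /mix !zz' ?ltn_add2l//; apply: shear_local => q qs.
by rewrite /refresh; case: ltnP => q3; rewrite zz'//; lia.
Qed.

Lemma walk_local s e z z' : agree (s + 5 * e) z z' -> agree s (walk s e z) (walk s e z').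
Proof.
elim: e z z' => [|e IH] z z'; first by rewrite muln0 addn0.
by rewrite mulnSr addnA => zz' /=; apply: IH; exact: mix_local.
Qed.

(** The first step is summed out by [csum_mix], the rest of the walk being part of [B]. A shear
    reads only lower bits, so [qstar A] still depends on [s] bits. *)
Lemma csum_walk s e A B : depends s A -> depends s B ->
  csum (s + 5 * e) (fun z => A z * B (walk s e z)) =
  32 ^+ e * csum s (fun z => iter e qstar A z * B z).
Proof.
elim: e A => [|e IH] A dA dB; first by rewrite muln0 addn0 mul1r.
rewrite mulnSr addnA /= (@csum_mix (s + 5 * e) A (fun z => B (walk s e z))); last 2 first.
- by apply: dependsW dA; rewrite leq_addr.
- by move=> z z' zz'; apply: dB; exact: walk_local.
rewrite IH//; last exact: depends_qstar.
by rewrite mulrA -exprS; congr (_ * _); apply: eq_csum => z; rewrite -iterSr.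
Qed.

Lemma iter_qstar s e A : depends s A -> csum s A = 0 ->
  [/\ depends s (iter e qstar A), csum s (iter e qstar A) = 0 &
  csum s (fun z => iter e qstar A z * iter e qstar A z) <=
  ((23 / 24) ^+ e) ^+ 2 * csum s (fun z => A z * A z)].
Proof.
move=> dA A0; elim: e => [|e [dI I0 IH]] /=; first by rewrite expr1n mul1r.
split; [exact: depends_qstar|by rewrite csum_qstar|].
apply: (le_trans (qstar_norm dI I0)).
apply: (le_trans (ler_wpM2l (sqr_ge0 _) IH)).
by rewrite mulrA -exprMn -exprS.
Qed.

Lemma qstarB A (a : R) z : qstar (fun z => A z - a) z = qstar A z - a.
Proof.
rewrite /qstar (eq_bigr (fun ob : bool * bool => forget3 A (shear ob.1 ob.2 z) - a)).
  rewrite sumrB sumr_const card_prod card_bool -[a *+ _]mulr_natl mulrBl.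
  by congr (_ - _); field.
by move=> [p c] _; rewrite /forget3 /forget; field.
Qed.

Definition cmean (s : nat) F : R := csum s F / 2 ^+ s.

(** The expander mixing lemma for the two ends of a walk: once [A] is centered, its norm contracts
    by [23 / 24] per step. The sign [q] treats both sides of the absolute value. *)
Lemma walk_mixing s e A B : depends s A -> depends s B ->
  (forall z, 0 <= A z <= 1) -> (forall z, 0 <= B z <= 1) ->
  `|cmean (s + 5 * e) (fun z => A z * B (walk s e z)) - cmean s A * cmean s B|
  <= (23 / 24) ^+ e.
Proof.
move=> dA dB A01 B01; pose a := cmean s A; pose A0 z := A z - a.
have dA0 : depends s A0 by move=> z z' zz'; rewrite /A0 (dA _ _ zz').
have p2 : (0 : R) < 2 ^+ s by rewrite exprn_gt0.
have sA0 : csum s A0 = 0.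
  by rewrite /A0 csumB csum_cst /a /cmean mulrCA divff ?gt_eqF// mulr1 subrr.
have itE z : iter e qstar A0 z = iter e qstar A z - a.
  elim: e z => //= e IH z; rewrite -qstarB; congr qstar.
  exact/funext.
have [dI I0 IN] := iter_qstar e dA0 sA0.
set r := (23 / 24) ^+ e; have r0 : 0 < r by rewrite exprn_gt0//; lra.
have a01 : 0 <= a <= 1.
  rewrite /a /cmean divr_ge0 ?(ltW p2)//=; last by apply: csum_ge0 => z; case/andP: (A01 z).
  rewrite ler_pdivrMr// mul1r -[leRHS]mulr1 -csum_cst; apply: le_csum => z.
  by case/andP: (A01 z).
have e1 : cmean (s + 5 * e) (fun z => A z * B (walk s e z)) - cmean s A * cmean s B =
    csum s (fun z => iter e qstar A0 z * B z) / 2 ^+ s.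
  rewrite /cmean csum_walk// exprD exprM.
  rewrite (_ : 2 ^+ 5 = 32 :> R); last by rewrite -natrX.
  rewrite [X in X / (_ * _)]mulrC invfM mulrACA divff ?expf_eq0 ?pnatr_eq0 ?andbF// mulr1.
  rewrite -/(cmean s A) -/a mulrA -mulrBl -csumZ -csumB; congr (_ / _).
  by apply: eq_csum => z; rewrite itE mulrBl.
rewrite e1 normrM normfV (gtr0_norm p2) ler_pdivrMr//.
have sq : csum s (fun z => A0 z * A0 z) <= 2 ^+ s.
  rewrite -[leRHS]mulr1 -csum_cst; apply: le_csum => z.
  by move: (A01 z) a01; rewrite /A0 => /andP[? ?] /andP[? ?]; nra.
have sB : csum s (fun z => B z * B z) <= 2 ^+ s.
  rewrite -[leRHS]mulr1 -csum_cst; apply: le_csum => z.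
  by move: (B01 z) => /andP[? ?]; nra.
(* AM-GM: [2 x y <= x^2 / r + r y^2] *)
have bound (q : R) : q ^+ 2 = 1 ->
    2 * (q * csum s (fun z => iter e qstar A0 z * B z)) <= 2 * (r * 2 ^+ s).
  move=> q1.
  apply: (@le_trans _ _ (r^-1 * csum s (fun z => iter e qstar A0 z * iter e qstar A0 z) +
     r * csum s (fun z => B z * B z))).
    rewrite -!csumZ -csumD; apply: le_csum => z; set x := iter _ _ _ _.
    rewrite -subr_ge0 (_ : _ - _ = r^-1 * (q * x - r * B z) ^+ 2).
      by rewrite mulr_ge0 ?sqr_ge0// invr_ge0 ltW.
    transitivity (r^-1 * (q ^+ 2 * x ^+ 2 - 2 * q * x * r * B z + r ^+ 2 * B z ^+ 2)).
      by rewrite q1; field; rewrite gt_eqF.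
    by ring.
  have : r^-1 * csum s (fun z => iter e qstar A0 z * iter e qstar A0 z) <= r * 2 ^+ s.
    rewrite mulrC ler_pdivrMr//; apply: (le_trans IN); rewrite -/r.
    by rewrite [leRHS]mulrAC -[r * r]expr2 ler_wpM2l// ?sqr_ge0.
  have : r * csum s (fun z => B z * B z) <= r * 2 ^+ s by rewrite ler_wpM2l// ltW.
  lra.
rewrite ler_norml; move: (bound 1) (bound (-1)); rewrite sqrrN expr1n => /(_ erefl) + /(_ erefl).
by rewrite mul1r mulN1r => ? ?; apply/andP; split; lra.
Qed.

End Mixing.

(** * The generator fools adaptive sequences of tests *)

Fixpoint seedlen (n : nat) (e : nat -> nat) (j : nat) : nat :=
  if j is j'.+1 then (seedlen n e j' + 5 * e j')%N else n.

Fixpoint points (n : nat) (e : nat -> nat) (j : nat) (z : nat -> bool) :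
    seq (nat -> bool) :=
  if j is j'.+1
  then points n e j' z ++ points n e j' (walk (seedlen n e j') (e j') z)
  else [:: z].

(** Random access to [points], along the binary digits of [i] from the top; this is the form that
    the program computes. *)
Fixpoint point (n : nat) (e : nat -> nat) (j i : nat) (z : nat -> bool) : nat -> bool :=
  if j is j'.+1 then
    if (2 ^ j' <= i)%N then point n e j' (i - 2 ^ j') (walk (seedlen n e j') (e j') z)
    else point n e j' i z
  else z.

Lemma size_points n e j z : size (points n e j z) = (2 ^ j)%N.
Proof. by elim: j z => //= j IH z; rewrite size_cat !IH expnS mul2n addnn. Qed.

Lemma nth_points n e j i z z0 : (i < 2 ^ j)%N -> nth z0 (points n e j z) i = point n e j i z.
Proof.
elim: j i z => [|j IH] i z; first by case: i.
rewrite expnS mul2n -addnn => ij /=; rewrite nth_cat size_points.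
by case: ltnP => ij'; rewrite IH//; lia.
Qed.

Section Fooling.
Context {R : realType} (n : nat) (T : finType).
Variable next : seq T -> (nat -> bool) -> T.
Hypothesis nextP : forall h, depends n (next h).
Implicit Types (h : seq T) (val : seq T -> R) (F : (nat -> bool) -> R).

Fixpoint outcome h (xs : seq (nat -> bool)) : seq T :=
  if xs is x :: xs' then next h x :: outcome (rcons h (next h x)) xs' else [::].

Lemma size_outcome h xs : size (outcome h xs) = size xs.
Proof. by elim: xs h => //= x xs IH h; rewrite IH. Qed.

Lemma outcome_cat h xs ys :
  outcome h (xs ++ ys) = outcome h xs ++ outcome (h ++ outcome h xs) ys.
Proof.
elim: xs h => [|x xs IH] h /=; first by rewrite cats0.
by rewrite IH cat_rcons.
Qed.

Lemma outcome_local e j h : depends (seedlen n e j) (fun z => outcome h (points n e j z)).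
Proof.
elim: j h => [|j IH] h z z' zz' /=; first by rewrite (nextP h zz').
rewrite !outcome_cat.
have zj : agree (seedlen n e j) z z'.
  by move=> p pj; apply: zz'; rewrite /= (leq_trans pj)// leq_addr.
rewrite (IH h _ _ zj); congr (_ ++ _).
by apply: (IH _); exact: walk_local.
Qed.

Fixpoint ideal (m : nat) val h : R :=
  if m is m'.+1 then cmean n (fun x => ideal m' val (rcons h (next h x))) else val h.

Lemma ideal_add a b val h : ideal (a + b) val h = ideal a (ideal b val) h.
Proof.
elim: a h => //= a IH h; congr (_ / _); apply: eq_csum => z; exact: IH.
Qed.

Lemma cmean_le s F (F' : (nat -> bool) -> R) : (forall z, F z <= F' z) -> cmean s F <= cmean s F'.
Proof. by move=> FF; rewrite ler_wpM2r ?invr_ge0 ?exprn_ge0// le_csum. Qed.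

Lemma cmean_cst s (a : R) : cmean s (fun=> a) = a.
Proof. by rewrite /cmean csum_cst mulrAC divff ?mul1r// expf_eq0 pnatr_eq0 andbF. Qed.

Lemma cmeanD s F (F' : (nat -> bool) -> R) : cmean s (fun z => F z + F' z) = cmean s F + cmean s F'.
Proof. by rewrite /cmean csumD mulrDl. Qed.

Lemma cmean01 s F : (forall z, 0 <= F z <= 1) -> 0 <= cmean s F <= 1.
Proof.
move=> F01; apply/andP; split.
  by rewrite -(cmean_cst s 0); apply: cmean_le => z; case/andP: (F01 z).
by rewrite -(cmean_cst s 1); apply: cmean_le => z; case/andP: (F01 z).
Qed.

Lemma cmean_sum (I : finType) s (F : I -> (nat -> bool) -> R) :
  cmean s (fun z => \sum_i F i z) = \sum_i cmean s (F i).
Proof. by rewrite /cmean csum_sum mulr_suml. Qed.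

Lemma ideal01 m val h : (forall g, 0 <= val g <= 1) -> 0 <= ideal m val h <= 1.
Proof. by move=> v01; elim: m h => //= m IH h; apply: cmean01. Qed.

Lemma sum_outcome (G : seq T -> R) h xs m : size xs = m ->
  \sum_(s : m.-tuple T) (outcome h xs == s)%:R * G s = G (outcome h xs).
Proof.
move=> xm; have /eqP sm : size (outcome h xs) = m by rewrite size_outcome.
rewrite (bigD1 (Tuple sm))//= eqxx mul1r big1 ?addr0// => s ns.
suff -> : (outcome h xs == s) = false by rewrite mul0r.
by apply/negbTE; apply: contraNneq ns => e; rewrite -val_eqE /= e.
Qed.

(** Each half contributes the error of the level below, and each transcript of the first half adds
    one mixing error. *)
Fixpoint error (e : nat -> nat) (j : nat) : R :=
  if j is j'.+1 then 2 * error e j' + #|T|%:R ^+ (2 ^ j') * (23 / 24) ^+ e j' else 0.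

(** A hybrid argument. Summing over the transcripts [t] of the first half writes the run as
    correlations between functions of the two ends of the walk. *)
Lemma points_fool e j val h : (forall g, 0 <= val g <= 1) ->
  `|cmean (seedlen n e j) (fun z => val (h ++ outcome h (points n e j z)))
     - ideal (2 ^ j) val h| <= error e j.
Proof.
elim: j val h => [|j IH] val h v01.
  rewrite /= [X in `|X - _|](_ : _ = cmean n (fun x => val (rcons h (next h x)))).
    by rewrite subrr normr0.
  by congr (_ / _); apply: eq_csum => z; rewrite cats1.
set m := (2 ^ j)%N in IH *; set s := seedlen n e j in IH *.
pose A (t : m.-tuple T) z : R := (outcome h (points n e j z) == t)%:R.
pose B (t : m.-tuple T) z : R :=
  val ((h ++ t) ++ outcome (h ++ t) (points n e j z)).
have dA t : depends s (A t).
  by move=> z z' zz'; rewrite /A (outcome_local h zz').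
have dB t : depends s (B t).
  by move=> z z' zz'; rewrite /B (outcome_local (h ++ t) zz').
have A01 t z : 0 <= A t z <= 1 by rewrite /A; case: eqP; rewrite ?lexx ?ler01.
have B01 t z : 0 <= B t z <= 1 by exact: v01.
have -> : cmean (seedlen n e j.+1) (fun z => val (h ++ outcome h (points n e j.+1 z))) =
    \sum_t cmean (s + 5 * e j) (fun z => A t z * B t (walk s (e j) z)).
  rewrite -cmean_sum; congr (_ / _); apply: eq_csum => z.
  rewrite (sum_outcome (fun t => val ((h ++ t) ++ outcome (h ++ t)
    (points n e j (walk s (e j) z)))) h (size_points n e j z)).
  by rewrite /= outcome_cat -catA.
have sA (G : seq T -> R) : \sum_t cmean s (A t) * G t =
    cmean s (fun z => G (outcome h (points n e j z))).
  transitivity (\sum_t cmean s (fun z => A t z * G t)).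
    apply: eq_bigr => t _; rewrite /cmean mulrAC; congr (_ / _).
    by rewrite mulrC -csumZ; apply: eq_csum => z; rewrite mulrC.
  rewrite -cmean_sum; congr (_ / _); apply: eq_csum => z.
  exact: sum_outcome (size_points n e j z).
(* Decoupling: the mixing bound, once for each transcript. *)
have e1 : `|\sum_t cmean (s + 5 * e j) (fun z => A t z * B t (walk s (e j) z)) -
     \sum_t cmean s (A t) * cmean s (B t)| <= #|T|%:R ^+ m * (23 / 24) ^+ e j.
  rewrite -sumrB; apply: (le_trans (ler_norm_sum _ _ _)).
  apply: (@le_trans _ _ (\sum_(t : m.-tuple T) (23 / 24) ^+ e j)).
    by apply: ler_sum => t _; exact: walk_mixing.
  by rewrite sumr_const card_tuple -natrX [leRHS]mulr_natl.
(* The second half becomes ideal, by induction from the history [h ++ t], averaged over [t]. *)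
have e2 : `|\sum_t cmean s (A t) * cmean s (B t) -
    \sum_t cmean s (A t) * ideal m val (h ++ t)| <= error e j.
  rewrite -sumrB; apply: (le_trans (ler_norm_sum _ _ _)).
  apply: (@le_trans _ _ (\sum_t cmean s (A t) * error e j)).
    apply: ler_sum => t _; rewrite -mulrBr normrM ger0_norm.
      by rewrite ler_wpM2l// ?IH//; case/andP: (cmean01 s (A01 t)).
    by case/andP: (cmean01 s (A01 t)).
  by rewrite (sA (fun=> _)) cmean_cst.
(* The first half becomes ideal, with the ideal value of the second half as its test. *)
have e3 := IH (ideal m val) h (fun g => ideal01 m g v01).
rewrite -(sA (fun t => ideal m val (h ++ t))) -ideal_add addnn -mul2n -expnS in e3.
rewrite /= -/m; set c := _ * _ in e1 *.
move: e1 e2 e3; rewrite !ler_norml => /andP[? ?] /andP[? ?] /andP[? ?].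
by apply/andP; split; lra.
Qed.

(** The union bound. The generator yields a power of two of points, of which the first [k] count;
    past length [k] the truncated difference charges nothing. *)
Lemma ideal_union (bad : pred T) (k m : nat) (delta : R) h : 0 <= delta ->
  (forall g, cmean n (fun x => (bad (next g x))%:R) <= delta) ->
  ideal m (fun g => (has bad (take k g))%:R) h <=
    (has bad (take k h))%:R + (k - size h)%:R * delta.
Proof.
move=> d0 bd; elim: m h => [|m IH] h /=; first by rewrite lerDl mulr_ge0.
have [kh|hk] := leqP k (size h).
  apply: (@le_trans _ _ (cmean n (fun=> (has bad (take k h))%:R))).
    apply: cmean_le => x; apply: (le_trans (IH _)).
    rewrite size_rcons (_ : k - _ = 0)%N; last by lia.
    rewrite mul0r addr0 -cats1 take_cat; case: ltnP => // hk.
    by rewrite (_ : k - size h = 0)%N ?take0 ?cats0 ?take_oversize//; lia.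
  by rewrite cmean_cst lerDl mulr_ge0.
apply: (@le_trans _ _ (cmean n (fun x => (bad (next h x))%:R +
   ((has bad (take k h))%:R + (k - (size h).+1)%:R * delta)))).
  apply: cmean_le => x; apply: (le_trans (IH _)).
  rewrite size_rcons addrA lerD2r !take_oversize ?size_rcons ?(ltnW hk)//.
  by rewrite has_rcons -natrD ler_nat; case: (bad _); case: (has _ _).
rewrite cmeanD cmean_cst addrCA lerD2l.
rewrite (_ : k - size h = (k - (size h).+1).+1)%N; last by lia.
by rewrite -natr1 mulrDl mul1r addrC lerD2l.
Qed.

(** Thirty-two steps at least halve the mixing error, and 32 is reached by five doublings in the
    program. The summands pay for the transcripts, for the doubling of the error over [J] levels and
    for the target [2 ^- L]. *)
Definition steps (l J L j : nat) : nat := (32 * (2 ^ j * l + J + L))%N.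

Lemma gap_pow q : (23 / 24 : R) ^+ (32 * q) <= 2 ^- q.
Proof.
rewrite exprM -exprVn; apply: lerXn2r; rewrite ?nnegrE ?exprn_ge0 ?invr_ge0//; lra.
Qed.

Lemma error_bound l J L : (#|T| <= 2 ^ l)%N -> error (steps l J L) J <= 2 ^- L.
Proof.
move=> Tl.
suff H j : error (steps l J L) j <= (2 ^+ j - 1) * 2 ^- (J + L).
  apply: (le_trans (H J)).
  have p : (0 : R) < 2 ^+ J by rewrite exprn_gt0.
  rewrite exprD invfM mulrA ler_piMl ?invr_ge0 ?exprn_ge0//.
  by rewrite ler_pdivrMr// mul1r gerBl.
elim: j => [|j IH] /=; first by rewrite expr0 subrr mul0r.
have : #|T|%:R ^+ (2 ^ j) * (23 / 24) ^+ steps l J L j <= 2 ^- (J + L) :> R.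
  apply: (@le_trans _ _ (2 ^+ (2 ^ j * l) * 2 ^- (2 ^ j * l + J + L))).
    apply: ler_pM; [by rewrite exprn_ge0|by rewrite exprn_ge0//; lra| |exact: gap_pow].
    by rewrite -!natrX ler_nat mulnC expnM leq_exp2r ?expn_gt0.
  by rewrite -addnA exprD invfM mulrA divff ?mul1r// expf_eq0 pnatr_eq0 andbF.
by move: IH; rewrite exprS; nra.
Qed.

Lemma points_union_bound (bad : pred T) (k l J L : nat) (delta : R) : 0 <= delta ->
  (#|T| <= 2 ^ l)%N ->
  (forall g, cmean n (fun x => (bad (next g x))%:R) <= delta) ->
  cmean (seedlen n (steps l J L) J)
    (fun z => (has bad (take k (outcome [::] (points n (steps l J L) J z))))%:R)
    <= k%:R * delta + 2 ^- L.
Proof.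
move=> d0 Tl bd; set e := steps l J L.
pose val h : R := (has bad (take k h))%:R.
have v01 g : 0 <= val g <= 1 by rewrite /val; case: has; rewrite ?lexx ?ler01.
have := points_fool e J [::] v01; rewrite ler_norml => /andP[_].
have := error_bound J L Tl; rewrite -/e.
have := ideal_union k (2 ^ J) [::] d0 bd; rewrite subn0 /= add0r.
rewrite -/val /=; lra.
Qed.

End Fooling.

(** * Shifting and rounding *)

Section Rounding.
Context {R : realType} (d : nat) (eps : R).
Hypothesis eps_gt0 : 0 < eps.
Implicit Types (W mu : 'rV[R]_d).

Definition round_to (g x : R) : R := (Num.floor (x / g))%:~R * g.

Definition grid : R := (eps + eps) *+ d.+1.

Definition offset (c : nat) : R := (eps + eps) *+ c.

(** By monotonicity of rounding, one inequality per coordinate makes the whole interval of radius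
    [eps] round to the same point. *)
Definition good W (c : nat) : bool := [forall j : 'I_d,
  round_to grid (W 0 j + offset c + eps) <= round_to grid (W 0 j + offset c - eps)].

(** The last good shift rather than the first, since the program overwrites a register at each good
    one; 0 is a default. *)
Fixpoint last_good W (m : nat) : nat :=
  if m is m'.+1 then if good W m' then m' else last_good W m' else 0.

Definition reply W (c : nat) : 'rV[R]_d :=
  \row_j round_to grid (W 0 j + offset c).

Lemma grid_gt0 : 0 < grid.
Proof. by rewrite /grid pmulrn_lgt0// addr_gt0. Qed.

Lemma le_round_to g x y : 0 < g -> x <= y -> round_to g x <= round_to g y.
Proof.
move=> g0 xy; rewrite ler_wpM2r ?(ltW g0)// ler_int; apply: le_floor.
by rewrite ler_wpM2r// invr_ge0 ltW.
Qed.

Lemma round_to_itv g x : 0 < g -> round_to g x <= x < round_to g x + g.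
Proof.
move=> g0; have /andP[h1 h2] := floor_itv (x / g).
rewrite -ler_pdivlMr// h1 /=.
by rewrite -[X in _ < _ + X]mul1r -mulrDl -ltr_pdivrMr// -[X in _ < _ + X]/(1%:~R) -rmorphD.
Qed.

(* Intervals of length [2 eps] shifted by multiples of [2 eps] tile a grid cell,
   so each coordinate spoils at most one of the [d + 1] shifts. *)
Lemma exists_good W : exists2 c, (c < d.+1)%N & good W c.
Proof.
apply: contrapT => nog.
have bad (c : 'I_d.+1) : {j : 'I_d |
    round_to grid (W 0 j + offset c - eps) < round_to grid (W 0 j + offset c + eps)}.
  apply: cid; have : ~~ good W c by apply/negP => gc; apply: nog; exists c.
  by rewrite negb_forall => /existsP[j]; rewrite -ltNge => ?; exists j.
have inj : injective (fun c => sval (bad c)).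
  suff H (c c' : 'I_d.+1) : (c < c')%N -> sval (bad c) = sval (bad c') -> False.
    move=> c c' /= cc'; apply/val_inj; case: (ltngtP c c') => // l; exfalso.
      exact: H l cc'.
    exact: H l (esym cc').
  move=> cc' e; have := svalP (bad c); have := svalP (bad c'); rewrite /= -e.
  move: (W 0 _) => x h' h.
  have g0 := grid_gt0.
  (* [b] and [b'] number grid points within [eps] of the two shifted values. The shifts differ by at
     least [2 eps], so these points are distinct, hence at least [grid] apart; but the shifts differ
     by at most [grid - 2 eps]. *)
  pose b := Num.floor ((x + offset c + eps) / grid).
  pose b' := Num.floor ((x + offset c' + eps) / grid).
  have lo c1 : round_to grid (x + offset c1 - eps) < round_to grid (x + offset c1 + eps) ->
      x + offset c1 - eps < (Num.floor ((x + offset c1 + eps) / grid))%:~R * grid.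
    rewrite /round_to ltr_pM2r// ltr_int floor_lt_int => l.
    by rewrite -ltr_pdivrMr.
  have hi c1 : (Num.floor ((x + offset c1 + eps) / grid))%:~R * grid <= x + offset c1 + eps.
    by have /andP[] := round_to_itv (x + offset c1 + eps) g0.
  have lb' := lo _ h'; have lb := lo _ h.
  have hb' := hi c'; have hb := hi c.
  rewrite -/b in lb hb; rewrite -/b' in lb' hb'.
  have off : offset c + (eps + eps) <= offset c'.
    by rewrite /offset -mulrSr; apply: ler_wpMn2l => //; rewrite addr_ge0 ?(ltW eps_gt0).
  have off' : offset c' <= offset c + (eps + eps) *+ d.
    rewrite /offset -mulrnDr; apply: ler_wpMn2l; first by rewrite addr_ge0 ?(ltW eps_gt0).
    by have := ltn_ord c'; lia.
  have bb : b%:~R * grid < b'%:~R * grid by lra.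
  rewrite ltr_pM2r// ltr_int -lezD1 -(ler_int R) rmorphD/= in bb.
  have bb2 : b%:~R * grid + grid <= b'%:~R * grid.
    by rewrite -[X in _ + X]mul1r -mulrDl ler_pM2r.
  have gE : grid = (eps + eps) *+ d + (eps + eps) by rewrite /grid mulrSr.
  by clear e bb; lra.
by have := leq_card _ inj; rewrite !card_ord ltnn.
Qed.

Lemma last_goodP W m : (exists2 c, (c < m)%N & good W c) ->
  (last_good W m < m)%N /\ good W (last_good W m).
Proof.
elim: m => [[]//|m IH] [c] /=; case: ifP => [gm _ _|gm]; first by split.
rewrite ltnS leq_eqVlt => /predU1P[->|cm gc]; first by rewrite gm.
by have [l g] := IH (ex_intro2 _ _ c cm gc); split => //; exact: ltnW.
Qed.

Lemma rv_norm_le (v : 'rV[R]_d) (x : R) : 0 <= x ->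
  (`|v| <= x) <-> forall j, `|v 0 j| <= x.
Proof.
move=> x0; rewrite /Num.norm /= mx_normrE; split => [h j|h].
  apply: le_trans h; exact: (le_bigmax _ (fun ij : 'I_1 * 'I_d => `|v ij.1 ij.2|) (0, j)).
by apply: bigmax_le => // -[i j] _ /=; rewrite (ord1 i); exact: h.
Qed.

(* A good shift makes the reply a function of the center and of the shift only. *)
Lemma reply_good W mu c : good W c -> `|W - mu| <= eps -> reply W c = reply mu c.
Proof.
move=> /forallP gc /(rv_norm_le _ (ltW eps_gt0)) h.
apply/rowP => j; rewrite !mxE; have g0 := grid_gt0.
have := h j; rewrite !mxE ler_norml => /andP[h1 h2].
have := gc j; set x := W 0 j in h1 h2 *; set y := mu 0 j in h1 h2 *.
have l1 : round_to grid (x + offset c - eps) <= round_to grid (x + offset c).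
  by apply: le_round_to => //; lra.
have l2 : round_to grid (x + offset c) <= round_to grid (x + offset c + eps).
  by apply: le_round_to => //; lra.
have l3 : round_to grid (x + offset c - eps) <= round_to grid (y + offset c).
  by apply: le_round_to => //; lra.
have l4 : round_to grid (y + offset c) <= round_to grid (x + offset c + eps).
  by apply: le_round_to => //; lra.
lra.
Qed.

(** Coordinatewise the error lies between [- grid] and [offset c]. A coordinate exists only if
    [d >= 1], and then [2 (d + 1) eps <= 4 eps d]. *)
Lemma reply_error mu c : (c <= d)%N -> `|reply mu c - mu| <= 4 * (eps * d%:R).
Proof.
move=> cd; apply/rv_norm_le => [|j].
  by rewrite !mulr_ge0// ltW.
have d0 : (0 < d)%N by case: d j => [[]|].
rewrite !mxE; have := round_to_itv (mu 0 j + offset c) grid_gt0.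
have : offset c <= (eps + eps) * d%:R.
  by rewrite mulr_natr; apply: ler_wpMn2l => //; rewrite addr_ge0 ?(ltW eps_gt0).
have : 0 <= offset c by rewrite mulrn_wge0// addr_ge0 ?(ltW eps_gt0).
have : grid = (eps + eps) * d%:R + (eps + eps) by rewrite /grid mulrSr mulr_natr.
have : eps <= eps * d%:R by rewrite ler_peMr ?(ltW eps_gt0)// ler1n.
by move=> ? ? ? ? /andP[? ?]; rewrite ler_norml; apply/andP; split; lra.
Qed.

End Rounding.

(** * The interaction as an adaptive sequence of finite-valued tests *)

Section Game.
Context {R : realType} (n k d : nat) (eps delta : R).
Hypothesis eps_gt0 : 0 < eps.
Hypothesis delta_ge0 : 0 <= delta.
Variables (f : seq 'rV[R]_d -> n.-tuple bool -> 'rV[R]_d) (ctr : seq 'rV[R]_d -> 'rV[R]_d).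
Hypothesis fP : forall ys, concentrated eps delta (f ys) (ctr ys).

Definition query_point (x : nat -> bool) : n.-tuple bool := [tuple x i | i < n].

Definition answer (W : 'rV[R]_d) : 'rV[R]_d := reply eps W (last_good eps W d.+1).

Definition replies_to (xs : seq (nat -> bool)) : seq 'rV[R]_d :=
  foldl (fun ys x => rcons ys (answer (f ys (query_point x)))) [::] xs.

Lemma size_replies_to xs : size (replies_to xs) = size xs.
Proof.
elim/last_ind: xs => // xs x IH.
by rewrite /replies_to foldl_rcons !size_rcons -/(replies_to xs) IH.
Qed.

Local Notation shift := (option 'I_d.+1).

(** The replies computed from centers and shifts: they depend on a history in a finite set and no
    longer on the values. After a failure, [None], the shift 0 is a placeholder. *)
Let expected (h : seq shift) : seq 'rV[R]_d :=
  foldl (fun ys (t : shift) => rcons ys (reply eps (ctr ys) (if t is Some c then c : nat else 0%N)))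
    [::] h.

Let next (h : seq shift) (x : nat -> bool) : shift :=
  let W := f (expected h) (query_point x) in
  if eps < `|W - ctr (expected h)| then None
  else Some (inord (last_good eps W d.+1)).

Let bad (t : shift) := t == None.

Lemma replies_expected h xs : ~~ has bad (outcome next h xs) ->
  foldl (fun ys x => rcons ys (answer (f ys (query_point x)))) (expected h) xs =
  expected (h ++ outcome next h xs).
Proof.
elim: xs h => [|x xs IH] h /=; first by rewrite cats0.
rewrite negb_or => /andP[b1 b2]; rewrite -cat_rcons -IH//; congr (foldl _ _ _).
rewrite /expected foldl_rcons -/(expected h); congr (rcons _ _).
move: b1; rewrite /bad /next; case: ltP => // le _.
have [l g] := last_goodP (exists_good eps_gt0 (f (expected h) (query_point x))).
by rewrite inordK// /answer; exact: reply_good.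
Qed.

Lemma nth_expected h i : (i < size h)%N -> exists2 c, (c <= d)%N &
  nth 0 (expected h) i = reply eps (ctr (take i (expected h))) c.
Proof.
have sz g : size (expected g) = size g.
  by elim/last_ind: g => // g t IH; rewrite /expected foldl_rcons !size_rcons -/(expected g) IH.
elim/last_ind: h => // h t IH; rewrite size_rcons ltnS leq_eqVlt => ih.
rewrite /expected foldl_rcons -/(expected h).
rewrite nth_rcons -cats1 take_cat sz; case/predU1P: ih => [->|ih].
  rewrite ltnn eqxx subnn take0 cats0; exists (if t is Some c then c : nat else 0%N) => //.
  by case: t => // c; rewrite -ltnS ltn_ord.
by rewrite ih; exact: IH.
Qed.

Lemma outcome_take h xs m : take m (outcome next h xs) = outcome next h (take m xs).
Proof. by elim: xs h m => [|x xs IH] h [|m] //=; rewrite IH. Qed.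

Lemma next_depends h : depends n (next h).
Proof.
move=> z z' zz'; rewrite /next.
suff -> : query_point z = query_point z' by [].
by apply: eq_from_tnth => i; rewrite !tnth_mktuple zz'.
Qed.

Lemma next_bad h : cmean n (fun x => (bad (next h x))%:R) <= delta.
Proof.
have := fP (expected h); rewrite /concentrated; apply: le_trans.
rewrite /cmean ler_wpM2r ?invr_ge0 ?exprn_ge0//.
rewrite -sum1_card natr_sum [leRHS]big_mkcond /=; apply: ler_sum => x _.
rewrite /bad /next; have -> : query_point (nth false x) = x.
  by apply: eq_from_tnth => i; rewrite tnth_mktuple -tnth_nth.
by rewrite inE; case: ltP.
Qed.

Definition missed (ys : seq 'rV[R]_d) : bool :=
  `[< exists2 i, (i < k)%N & 4 * (eps * d%:R) < `|nth 0 ys i - ctr (take i ys)| >].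

(** Without a failure in the first [k] tests the replies are the expected ones, and [reply_error]
    excludes a miss. [d.+2] counts the [d.+1] shifts and the failure. *)
Lemma replies_missed (l J L : nat) (e := steps l J L) (m := seedlen n e J) :
  (k <= 2 ^ J)%N -> (d.+2 <= 2 ^ l)%N ->
  csum m (fun z => (missed (replies_to (mkseq (fun i => point n e J i z) k)))%:R)
  <= 2 ^+ m * (k%:R * delta + 2 ^- L).
Proof.
move=> kJ dl; rewrite mulrC -ler_pdivrMr ?exprn_gt0//.
have Tl : (#|{: shift}| <= 2 ^ l)%N by rewrite card_option card_ord.
apply: le_trans (points_union_bound next_depends k J L delta_ge0 Tl next_bad).
apply: cmean_le => z; rewrite ler_nat.
have -> : mkseq (fun i => point n e J i z) k = take k (points n e J z).
  apply: (@eq_from_nth _ z); first by rewrite size_mkseq size_takel// size_points.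
  rewrite size_mkseq => i ik; rewrite nth_mkseq// nth_take// nth_points//.
  exact: leq_trans kJ.
rewrite outcome_take -/e; set xs := take k _.
have sxs : size xs = k by rewrite size_takel// size_points.
rewrite /missed; case: asboolP => //= -[i ik]; rewrite lt0b; apply: contraTT => nb.
rewrite /replies_to -[X in foldl _ X _]/(expected [::]) replies_expected//= -leNgt.
have [|c cd ->] := @nth_expected (outcome next [::] xs) i; first by rewrite size_outcome sxs.
exact: reply_error.
Qed.

End Game.

(** * The program of the steward *)

Section Programs.
Local Open Scope nat_scope.

Local Notation V r := (NLoad (NConst r)).
Local Notation "r :=N e" := (NSet (NConst r) e) (at level 70).
Local Notation "r :=R e" := (RSet (NConst r) e) (at level 70).
Local Notation "c ;; c'" := (Seq c c') (at level 80, right associativity).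
Local Notation C c := (NConst c).
Local Notation RV r := (RLoad (NConst r)).

(** * A program logic with step counts *)

Section Logic.
Context {R : realType} {n d : nat}.
Variable g : seq 'rV[R]_d -> n.-tuple bool -> 'rV[R]_d.
Implicit Types (st : state R d) (c : com) (Q : state R d -> Prop).

(** Total correctness with a step bound. The same run works on top of every stack [K], which makes
    the rules compose. *)
Definition wp c (T : nat) Q st : Prop := exists t st',
  [/\ (t <= T)%N, Q st' & forall K, iter t (step g) (c :: K, st) = (K, st')].

Definition nset st a v :=
  State (upd (nmem st) a v) (rmem st) (tape st) (asked st) (replies st).

Definition rset st a v :=
  State (nmem st) (upd (rmem st) a v) (tape st) (asked st) (replies st).

Lemma wp_le T T' c Q st : wp c T Q st -> (T <= T')%N -> wp c T' Q st.
Proof. by move=> [t [st' [tT q e]]] TT'; exists t, st'; split=> //; exact: leq_trans TT'. Qed.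

Lemma wp_skip Q st : Q st -> wp Skip 1 Q st.
Proof. by move=> q; exists 1, st; split=> // K; case: st q. Qed.

Lemma wp_nset a e Q st :
  Q (nset st (neval (nmem st) a) (neval (nmem st) e)) -> wp (NSet a e) 1 Q st.
Proof. by move=> q; exists 1; eexists; split; [by []|exact: q|by case: st {q}]. Qed.

Lemma wp_rset a e Q st :
  Q (rset st (neval (nmem st) a) (reval (nmem st) (rmem st) e)) -> wp (RSet a e) 1 Q st.
Proof. by move=> q; exists 1; eexists; split; [by []|exact: q|by case: st {q}]. Qed.

Lemma wp_flip a nm rm b tp ak rs Q :
  Q (State (upd nm (neval nm a) (nat_of_bool b)) rm tp ak rs) ->
  wp (Flip a) 1 Q (State nm rm (b :: tp) ak rs).
Proof. by move=> q; exists 1; eexists; split; [by []|exact: q|]. Qed.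

Lemma wp_query a b nm rm tp rs Q :
  Q (State nm (write_vec rm (neval nm b) (g rs (read_point n nm (neval nm a)))) tp true rs) ->
  wp (Query a b) 1 Q (State nm rm tp false rs).
Proof. by move=> q; exists 1; eexists; split; [by []|exact: q|]. Qed.

Lemma wp_answer a nm rm tp rs Q :
  Q (State nm rm tp false (rcons rs (read_vec d rm (neval nm a)))) ->
  wp (Answer a) 1 Q (State nm rm tp true rs).
Proof. by move=> q; exists 1; eexists; split; [by []|exact: q|]. Qed.

Lemma wp_seq T1 T2 c1 c2 Q st :
  wp c1 T1 (fun st' => wp c2 T2 Q st') st -> wp (Seq c1 c2) (T1 + T2 + 1) Q st.
Proof.
move=> [t1 [st1 [tT1 [t2 [st2 [tT2 q e2]]] e1]]]; exists (t2 + t1 + 1), st2.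
split=> //; first by lia.
move=> K; have e0 : step g (Seq c1 c2 :: K, st) = (c1 :: c2 :: K, st) by case: (st).
by rewrite addn1 iterSr e0 iterD e1 e2.
Qed.

Lemma wp_if T1 T2 b c1 c2 Q st :
  (beval (nmem st) (rmem st) b -> wp c1 T1 Q st) ->
  (beval (nmem st) (rmem st) b = false -> wp c2 T2 Q st) ->
  wp (If b c1 c2) (T1 + T2 + 1) Q st.
Proof.
move=> h1 h2; pose c := if beval (nmem st) (rmem st) b then c1 else c2.
have [t [st' [tT q e]]] : wp c (T1 + T2) Q st.
  rewrite /c; case: ifP => [/h1|/h2] h; apply: (wp_le h); [exact: leq_addr|exact: leq_addl].
exists (t + 1), st'; split=> //; first by lia.
move=> K; have e0 : step g (If b c1 c2 :: K, st) = (c :: K, st) by rewrite /c; case: (st).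
by rewrite addn1 iterSr e0.
Qed.

Lemma wp_while (I : nat -> state R d -> Prop) N T b c Q st :
  I 0 st ->
  (forall i st, (i < N)%N -> I i st ->
     beval (nmem st) (rmem st) b /\ wp c T (I i.+1) st) ->
  (forall st, I N st -> beval (nmem st) (rmem st) b = false /\ Q st) ->
  wp (While b c) (N * (T + 1) + 1) Q st.
Proof.
move=> I0 IS IN.
have [i iN] : {i | i = 0%N} by exists 0%N.
rewrite -iN in I0; rewrite -[N in (N * _)%N]subn0 -{1}iN.
have : (i <= N)%N by rewrite iN.
elim: {iN} (N - i)%N {-2}i (erefl (N - i)%N) st I0 => [|m IH] {}i im st Ii iN.
  have iE : i = N by lia.
  rewrite iE in Ii; have [bF q] := IN _ Ii.
  exists 1, st; split=> //; first by lia.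
  move=> K /=.
  by case: st bF {Ii q} => nm rm tp ak rs /= ->.
have iltN : (i < N)%N by lia.
have [bT [t [st' [tT q e]]]] := IS _ _ iltN Ii.
have [||t' [st2 [tT' q2 e2]]] := IH i.+1 _ st' q; [by lia|by lia|].
exists (t' + t + 1), st2; split=> //; first by lia.
move=> K; have e0 : step g (While b c :: K, st) = (c :: While b c :: K, st).
  by case: st bT {Ii e} => nm rm tp ak rs /= ->.
by rewrite addn1 iterSr e0 iterD e e2.
Qed.

(** The bound [b] is evaluated again before each pass, so [wp_for] asks the invariant to fix its
    value. *)
Definition For (r : nat) (b : nexp) (c : com) : com :=
  Seq (NSet (NConst r) (NConst 0))
    (While (NLe (NAdd (NLoad (NConst r)) (NConst 1)) b)
       (Seq c (NSet (NConst r) (NAdd (NLoad (NConst r)) (NConst 1))))).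

Lemma wp_for (I : nat -> state R d -> Prop) N T r b c Q st :
  I 0 (nset st r 0) ->
  (forall i st, (i <= N)%N -> I i st -> nmem st r = i /\ neval (nmem st) b = N) ->
  (forall i st, (i < N)%N -> I i st ->
     wp c T (fun st' => I i.+1 (nset st' r (nmem st' r + 1)%N)) st) ->
  (forall st, I N st -> Q st) ->
  wp (For r b c) (N * (T + 3) + 3) Q st.
Proof.
move=> I0 Ir IS IN.
have -> : (N * (T + 3) + 3 = 1 + (N * (T + 1 + 1 + 1) + 1) + 1)%N by lia.
apply: wp_seq; apply: wp_nset; apply: (@wp_while I) => //.
- move=> i st' iN Ii; have [ri bN] := Ir i st' (ltnW iN) Ii.
  rewrite /= ri bN addn1 iN; split=> //.
  apply: wp_seq; have [t [st2 [tT q e]]] := IS _ _ iN Ii.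
  by exists t, st2; split=> //; apply: wp_nset.
- move=> st' IN'; have [ri bN] := Ir N st' (leqnn N) IN'.
  by rewrite /= ri bN addn1 ltnn; split=> //; exact: IN.
Qed.

End Logic.

(* Below address 24 (8 for the reals) the memory holds registers, listed in [l];
   above it holds arrays. *)
Definition nmemory (l : seq nat) (arr : nat -> nat) : nat -> nat := fun a =>
  if (a < 24)%N then nth 0%N l a else arr (a - 24)%N.

Definition rmemory (R : realType) (l : seq R) (arr : nat -> R) : nat -> R := fun a =>
  if (a < 8)%N then nth 0%R l a else arr (a - 8)%N.

Lemma nmemory_arr l arr x : nmemory l arr (24 + x)%N = arr x.
Proof. by rewrite /nmemory ltnNge leq_addr addKn. Qed.

Lemma nmemory_reg l arr r : (r < 24)%N -> nmemory l arr r = nth 0%N l r.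
Proof. by rewrite /nmemory => ->. Qed.

Lemma upd_arr l arr x v : upd (nmemory l arr) (24 + x)%N v = nmemory l (upd arr x v).
Proof.
apply/funext => a; rewrite /upd /nmemory; case: ltnP => h.
  by rewrite ltn_eqF// (leq_trans h)// leq_addr.
by rewrite -{1}(subnKC h) eqn_add2l.
Qed.

Lemma upd_reg l arr r v : (r < 24)%N ->
  upd (nmemory l arr) r v = nmemory (set_nth 0%N l r v) arr.
Proof.
move=> r24; apply/funext => a; rewrite /upd /nmemory; case: ltnP => h.
  by rewrite nth_set_nth.
by rewrite gtn_eqF// (leq_trans r24).
Qed.

Section RealMem.
Context {R : realType}.

Lemma rmemory_arr (l : seq R) arr x : rmemory l arr (8 + x)%N = arr x.
Proof. by rewrite /rmemory ltnNge leq_addr addKn. Qed.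

Lemma rmemory_reg (l : seq R) arr r : (r < 8)%N -> rmemory l arr r = nth 0%R l r.
Proof. by rewrite /rmemory => ->. Qed.

Lemma rupd_arr (l : seq R) arr x v : upd (rmemory l arr) (8 + x)%N v = rmemory l (upd arr x v).
Proof.
apply/funext => a; rewrite /upd /rmemory; case: ltnP => h.
  by rewrite ltn_eqF// (leq_trans h)// leq_addr.
by rewrite -{1}(subnKC h) eqn_add2l.
Qed.

Lemma rupd_reg (l : seq R) arr r v : (r < 8)%N ->
  upd (rmemory l arr) r v = rmemory (set_nth 0%R l r v) arr.
Proof.
move=> r8; apply/funext => a; rewrite /upd /rmemory; case: ltnP => h.
  by rewrite nth_set_nth.
by rewrite gtn_eqF// (leq_trans r8).
Qed.

End RealMem.

Ltac ev := rewrite /nset /rset /= ?nmemory_arr ?rmemory_arr ?nmemory_reg ?rmemory_reg //=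
  ?upd_arr ?rupd_arr ?upd_reg ?rupd_reg //= ?nmemory_reg ?rmemory_reg //=.
Ltac assign := first [eapply wp_nset | eapply wp_rset]; ev.

(* Registers: 0, 1, 2 hold [n], [k], [d]; 3 the depth [J] of the generator; 4 and 5
   the logarithms [l] of [d + 2] and [L] of [1 / gamma]; 6 the length [m] of the
   seed; 7 and 8 powers of two and multiples of them; 9 the length of a walk; 10
   the index of the point sought in the current level; 11 the current length of
   the working copy; 12 and 13 the parity and the hop of a shear; 14 whether the
   current shift is good; 15 to 20 loop counters.
   The seed is at [24, ..., 24 + m - 1] and its working copy follows. Real
   registers: 0, 1, 2 hold [eps], [delta], [gamma]; 3 the grid; 4 the current
   shift; 5 a good one; the value of the function is stored from 8 on. *)
Definition log_up : com :=
  9 :=N C 0 ;; 7 :=N C 1 ;;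
  For 17 (V 8) (If (NLe (NAdd (V 7) (C 1)) (V 8))
    (7 :=N NAdd (V 7) (V 7) ;; 9 :=N NAdd (V 9) (C 1)) Skip).

Definition work x : nexp := NAdd (NConst 24) (NAdd (NLoad (NConst 6)) x).

(** The shear is done in place, as its sources are never targets. For bits, the sum of the two
    truncated differences is the exclusive or. *)
Definition mix_com : com :=
  11 :=N NSub (V 11) (C 5) ;;
  12 :=N NLoad (work (NAdd (V 11) (C 3))) ;;
  13 :=N NAdd (C 1) (NAdd (NLoad (work (NAdd (V 11) (C 4)))) (NLoad (work (NAdd (V 11) (C 4))))) ;;
  NSet (work (C 0)) (NLoad (work (V 11))) ;;
  NSet (work (C 1)) (NLoad (work (NAdd (V 11) (C 1)))) ;;
  NSet (work (C 2)) (NLoad (work (NAdd (V 11) (C 2)))) ;;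
  For 19 (V 11)
    (let q := NAdd (V 12) (NAdd (V 19) (V 19)) in
     let p := NAdd q (V 13) in
     If (NLe (NAdd p (C 1)) (V 11))
       (NSet (work p) (NAdd (NSub (NLoad (work p)) (NLoad (work q)))
                         (NSub (NLoad (work q)) (NLoad (work p)))))
       Skip).

Lemma upd_add_ne (T : Type) (f : nat -> T) m x y v :
  y != x -> upd f (m + x) v (m + y) = f (m + y).
Proof. by move=> /negbTE xy; rewrite /upd eqn_add2l xy. Qed.

Lemma odd_sub_hop b q : hop b <= q -> odd (q - hop b) = ~~ odd q.
Proof. by move=> hq; rewrite oddB// odd_hop addbT. Qed.

(** * Correctness of the logarithm and of one step of the walk *)

Section Blocks.
Context {R : realType} {n d : nat}.
Variable g : seq 'rV[R]_d -> n.-tuple bool -> 'rV[R]_d.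
Implicit Types (rm : nat -> R) (tp : seq bool) (ak : bool) (rs : seq 'rV[R]_d)
  (Q : state R d -> Prop).
Implicit Types a : nat.

(** The power of two stops growing once it reaches [a8], hence the minimum in the invariant; [a8]
    passes suffice because [a8 <= 2 ^ a8]. *)
Lemma wp_log_up a0 a1 a2 a3 a4 a5 a6 a7 a8 a9 a10 a11 a12 a13 a14 a15 a16 a17 a18 a19 a20
    arr rm tp ak rs Q :
  Q (State (nmemory [:: a0; a1; a2; a3; a4; a5; a6; 2 ^ up_log 2 a8; a8; up_log 2 a8; a10;
    a11; a12; a13; a14; a15; a16; a8; a18; a19; a20] arr) rm tp ak rs) ->
  wp g log_up (8 * a8 + 7) Q (State (nmemory [:: a0; a1; a2; a3; a4; a5; a6; a7; a8; a9; a10;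
    a11; a12; a13; a14; a15; a16; a17; a18; a19; a20] arr) rm tp ak rs).
Proof.
move=> q; eapply wp_le.
  eapply wp_seq; assign.
  eapply wp_seq; assign.
  eapply (@wp_for _ _ _ _ (fun i st => st = State (nmemory [:: a0; a1; a2; a3; a4; a5; a6;
     2 ^ minn i (up_log 2 a8); a8; minn i (up_log 2 a8); a10;
    a11; a12; a13; a14; a15; a16; i; a18; a19; a20] arr) rm tp ak rs) a8).
  - by ev; rewrite min0n.
  - by move=> i st _ ->; ev.
  - move=> i st i8 ->; eapply wp_if; ev; rewrite addn1.
      move=> l; eapply wp_seq; assign; assign.
      have iu : i < up_log 2 a8.
        rewrite ltnNge; apply/negP => ui; move: l; rewrite ltnNge (minn_idPr ui).
        by rewrite up_logP.
      by rewrite (minn_idPl iu) (minn_idPl (ltnW iu)) addnn -mul2n -expnS addn1.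
    move=> /negbT; rewrite -leqNgt => l; eapply wp_skip; ev.
    have ui : up_log 2 a8 <= i.
      have [//|iu] := leqP (up_log 2 a8) i.
      by move: l; rewrite (minn_idPl (ltnW iu)) /=
        => /(up_log_min (isT : 1 < 2)); rewrite leqNgt iu.
    by rewrite !(minn_idPr _)// ?addn1// ltnW.
  - move=> st ->; rewrite (minn_idPr _)//.
    by apply: up_log_min => //; apply/ltnW/ltn_expl.
by lia.
Qed.

Lemma wp_mix (s m : nat) (sd z : nat -> bool)
    a0 a1 a2 a3 a4 a5 a7 a8 a9 a10 a12 a13 a14 a15 a16 a17 a18 a19 a20
    (arr : nat -> nat) rm tp ak rs Q :
  (forall p, p < m -> arr p = sd p) ->
  (forall p, p < s + 5 -> arr (m + p) = z p) ->
  (forall (arr' : nat -> nat) b12 b13, (forall p, p < m -> arr' p = sd p) ->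
    (forall p, p < s -> arr' (m + p) = mix s z p) ->
    Q (State (nmemory [:: a0; a1; a2; a3; a4; a5; m; a7; a8; a9; a10;
      s; b12; b13; a14; a15; a16; a17; a18; s; a20] arr') rm tp ak rs)) ->
  wp g mix_com (8 * s + 20) Q (State (nmemory [:: a0; a1; a2; a3; a4; a5; m; a7; a8; a9; a10;
    s + 5; a12; a13; a14; a15; a16; a17; a18; a19; a20] arr) rm tp ak rs).
Proof.
move=> seed zs q; eapply wp_le.
  eapply wp_seq; assign; rewrite addnK.
  eapply wp_seq; assign; rewrite zs ?ltn_add2l//.
  eapply wp_seq; assign; rewrite zs ?ltn_add2l//.
  set o := z (s + 3); set b := z (s + 4).
  have -> : 1 + (b + b) = hop b by case: b.
  eapply wp_seq; assign; rewrite zs; last by lia.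
  eapply wp_seq; assign; rewrite upd_add_ne ?zs ?ltn_add2l//; last by lia.
  eapply wp_seq; assign; rewrite !upd_add_ne ?zs ?ltn_add2l//; try by lia.
  set arr1 := upd _ (m + 2) _.
  have arr1z p : p < s -> arr1 (m + p) = refresh s z p.
    move=> ps; rewrite /arr1 /upd !eqn_add2l /refresh.
    case: p ps => [|[|[|p]]] ps; rewrite ?addn0//=.
    by rewrite zs// (leq_trans ps)// leq_addr.
  have arr1s p : p < m -> arr1 p = sd p.
    by move=> pm; rewrite /arr1 /upd !ltn_eqF ?(leq_trans pm) ?leq_addr// seed.
  (* After [x] passes, the additions with source below [o + 2 x] are done. *)
  eapply (@wp_for _ _ _ _ (fun x st => exists arr' : nat -> nat, [/\
     forall p, p < m -> arr' p = sd p,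
     forall p, p < s -> arr' (m + p) = refresh s z p (+)
      [&& hop b <= p, odd (p - hop b) == o, p - hop b < o + (x + x) & refresh s z (p - hop b)] &
     st = State (nmemory [:: a0; a1; a2; a3; a4; a5; m; a7; a8; a9; a10;
      s; o : nat; hop b; a14; a15; a16; a17; a18; x; a20] arr') rm tp ak rs]) s).
  - exists arr1; split=> //; last by ev.
    move=> p ps; rewrite arr1z//.
    suff -> : [&& hop b <= p, odd (p - hop b) == o, p - hop b < o + (0 + 0)
       & refresh s z (p - hop b)] = false by rewrite addbF.
    by case: (p - hop b) => [|r]; case: (o) => //=; rewrite ?andbF//.
  - by move=> x st _ [arr' [_ _ ->]]; ev.
  - move=> x st xs [arr' [seed' z' ->]].
    eapply wp_if; ev.
      move=> ps; assign.
      exists (upd arr' (m + (o + (x + x) + hop b))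
         (refresh s z (o + (x + x) + hop b) (+) refresh s z (o + (x + x)))).
      have ps' : o + (x + x) + hop b < s by rewrite -addn1.
      split.
      + move=> p pm; rewrite /upd ltn_eqF ?seed'//.
        by rewrite (leq_trans pm)// leq_addr.
      + move=> p pl; rewrite /upd eqn_add2l; case: eqP => [->|np].
          rewrite leq_addl addnK oddD addnn odd_double addbF oddb eqxx /=.
          by rewrite ltn_add2l addnn ltn_double ltnS leqnn.
        rewrite z'//; congr (nat_of_bool (_ (+) _)).
        case: (leqP (hop b) p) => //= hp; case: eqP => //= op.
        congr andb; apply/idP/idP => l; first by lia.
        have := odd_double_half (p - hop b); rewrite op -addnn => e.
        suff : (p - hop b)./2 <> x by lia.
        by move=> ex; apply: np; rewrite ex in e; lia.
      + rewrite addn1; congr (State (nmemory _ (upd _ _ _)) _ _ _ _).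
        rewrite !z'//; last by rewrite (leq_trans _ ps')// ltnS leq_addr.
        rewrite leq_addl addnK oddD addnn odd_double addbF oddb eqxx /= ltnn /= addbF.
        set u := refresh _ _ _; set v := refresh s z (o + x.*2).
        set w := [&& _, _, _ & _].
        (* The source has parity [o], so no earlier pass wrote to it. *)
        have -> : w = false.
          rewrite /w; have [hl|//] := leqP (hop b).
          by rewrite odd_sub_hop// oddD odd_double addbF oddb; case: (o).
        by rewrite addbF; case: u; case: v.
    move=> /negbT; rewrite -ltnNge addn1 ltnS => sl; eapply wp_skip; ev.
    exists arr'; split=> //; last by rewrite addn1.
    move=> p ps; rewrite z'//; congr (nat_of_bool (_ (+) _)).
    case: (leqP (hop b) p) => //= hp; case: eqP => //= op.
    by congr andb; apply/idP/idP => l; lia.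
  - move=> st [arr' [seed' z' ->]]; apply: q => // p ps; rewrite z'//.
    rewrite /mix /shear -/o -/b; congr (nat_of_bool (_ (+) _)).
    case: (leqP (hop b) p) => //= hp; case: eqP => //= op.
    by rewrite (_ : p - hop b < o + (s + s))//; lia.
by lia.
Qed.

End Blocks.

(** * Computing one point of the generator *)

Definition steps_com : com :=
  9 :=N NAdd (V 8) (NAdd (V 3) (V 5)) ;;
  9 :=N NAdd (V 9) (V 9) ;; 9 :=N NAdd (V 9) (V 9) ;; 9 :=N NAdd (V 9) (V 9) ;;
  9 :=N NAdd (V 9) (V 9) ;; 9 :=N NAdd (V 9) (V 9).

Definition times5 (e : nexp) : nexp := NAdd e (NAdd e (NAdd e (NAdd e e))).

(** The counter [t] in register 16 stands for the level [j = J - t - 1]; [2 ^ j] and [2 ^ j * l] are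
    obtained by doubling. The working copy is then either walked or cut down to the seed of level
    [j]. *)
Definition level_com : com :=
  7 :=N C 1 ;; 8 :=N V 4 ;;
  For 17 (NSub (NSub (V 3) (V 16)) (C 1))
    (7 :=N NAdd (V 7) (V 7) ;; 8 :=N NAdd (V 8) (V 8)) ;;
  steps_com ;;
  If (NLe (V 7) (V 10))
    (10 :=N NSub (V 10) (V 7) ;; For 18 (V 9) mix_com)
    (11 :=N NSub (V 11) (times5 (V 9))).

Definition point_com : com :=
  10 :=N V 15 ;; 11 :=N V 6 ;; For 16 (V 3) level_com.

Section Points.
Context {R : realType} {n d : nat}.
Variable g : seq 'rV[R]_d -> n.-tuple bool -> 'rV[R]_d.
Implicit Types (rm : nat -> R) (tp : seq bool) (ak : bool) (rs : seq 'rV[R]_d)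
  (Q : state R d -> Prop) (arr : nat -> nat).

Lemma wp_steps a0 a1 a2 a3 a4 a5 a6 a7 a8 a9 a10 a11 a12 a13 a14 a15 a16 a17 a18 a19 a20
    arr rm tp ak rs Q :
  Q (State (nmemory [:: a0; a1; a2; a3; a4; a5; a6; a7; a8; 32 * (a8 + a3 + a5); a10;
    a11; a12; a13; a14; a15; a16; a17; a18; a19; a20] arr) rm tp ak rs) ->
  wp g steps_com 11 Q (State (nmemory [:: a0; a1; a2; a3; a4; a5; a6; a7; a8; a9; a10;
    a11; a12; a13; a14; a15; a16; a17; a18; a19; a20] arr) rm tp ak rs).
Proof.
move=> q; eapply wp_le.
  do 5 (eapply wp_seq; assign).
  assign; rewrite !addnn.
  by rewrite (_ : _.*2 = 32 * (a8 + a3 + a5))//; lia.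
by [].
Qed.

(** The index and the string descend one level with the value of [point] unchanged. A walk has at
    most [M] steps because its instructions are part of the seed. *)
Lemma wp_level (J l L t M : nat) (sd z : nat -> bool) (rem : nat) (e := steps l J L)
    (j := J - t.+1) (m := seedlen n e J)
    a0 a1 a2 a7 a8 a9 a12 a13 a14 a15 a17 a18 a19 a20 arr rm tp ak rs Q :
  t < J -> m <= M -> J <= M ->
  (forall p, p < m -> arr p = sd p) ->
  (forall p, p < seedlen n e j.+1 -> arr (m + p) = z p) ->
  (forall rem' z' b7 b8 b9 b12 b13 b17 b18 b19 arr',
    point n e j rem' z' = point n e j.+1 rem z ->
    (forall p, p < m -> arr' p = sd p) ->
    (forall p, p < seedlen n e j -> arr' (m + p) = z' p) ->
    Q (State (nmemory [:: a0; a1; a2; J; l; L; m; b7; b8; b9; rem'; seedlen n e j;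
      b12; b13; a14; a15; t; b17; b18; b19; a20] arr') rm tp ak rs)) ->
  wp g level_com (M * (8 * M + 29) + 50) Q
    (State (nmemory [:: a0; a1; a2; J; l; L; m; a7; a8; a9; rem; seedlen n e j.+1;
      a12; a13; a14; a15; t; a17; a18; a19; a20] arr) rm tp ak rs).
Proof.
move=> tJ mM JM seed zs q.
have sM i : i <= J -> seedlen n e i <= M.
  move=> iJ; apply: leq_trans mM; rewrite /m -(subnKC iJ).
  by elim: (J - i) => [|r IH]; rewrite ?addn0// addnS /= (leq_trans IH)// leq_addr.
have jJ : j.+1 <= J by rewrite /j; lia.
have sjM := sM _ jJ; rewrite /= in sjM.
eapply wp_le.
  eapply wp_seq; assign.
  eapply wp_seq; assign.
  eapply wp_seq.
  eapply (@wp_for _ _ _ _ (fun i st => st = State (nmemory [:: a0; a1; a2; J; l; L; m; 2 ^ i;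
     2 ^ i * l; a9; rem; seedlen n e j.+1;
      a12; a13; a14; a15; t; i; a18; a19; a20] arr) rm tp ak rs) j).
  - by ev; rewrite mul1n.
  - by move=> i st _ ->; ev; rewrite /j; split=> //; lia.
  - move=> i st ij ->; eapply wp_seq; assign; assign.
    by rewrite !addnn addn1 -!mul2n expnS mulnA.
  move=> st ->; eapply wp_seq; apply: wp_steps; rewrite -/(steps l J L j) -/e.
  eapply wp_if; ev.
    move=> jr; eapply wp_seq; assign.
    (* The rest of the walk from the current string ends where the whole walk from [z] does. *)
    eapply (@wp_for _ _ _ _ (fun i st => exists z' b12 b13 b19 arr', [/\
      walk (seedlen n e j) (e j - i) z' = walk (seedlen n e j) (e j) z,
      (forall p, p < m -> arr' p = sd p),
      (forall p, p < seedlen n e j + 5 * (e j - i) -> arr' (m + p) = z' p) &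
      st = State (nmemory [:: a0; a1; a2; J; l; L; m; 2 ^ j; 2 ^ j * l; e j; rem - 2 ^ j;
      seedlen n e j + 5 * (e j - i); b12; b13; a14; a15; t; j; i; b19; a20] arr')
      rm tp ak rs]) (e j)).
    - by exists z, a12, a13, a19, arr; rewrite subn0; split=> //; ev.
    - by move=> i st1 _ [z' [b12 [b13 [b19 [arr' [_ _ _ ->]]]]]]; ev.
    - move=> i st1 ie [z' [b12 [b13 [b19 [arr' [w' s' zs' ->]]]]]].
      have eE : e j - i = (e j - i.+1).+1 by lia.
      rewrite eE mulnSr addnA in zs' *.
      apply: (@wp_le _ _ _ _ (8 * (seedlen n e j + 5 * (e j - i.+1)) + 20) (8 * M + 20)).
        eapply wp_mix; [exact: s'|exact: zs'|] => arr2 c12 c13 s2 z2.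
        exists (mix (seedlen n e j + 5 * (e j - i.+1)) z'), c12, c13,
          (seedlen n e j + 5 * (e j - i.+1)), arr2; split=> //.
          by rewrite -w' eE.
        by ev; rewrite addn1.
      by rewrite leq_add2r leq_mul2l /= (leq_trans _ sjM)// leq_add2l leq_mul2l leq_subr.
    move=> st' [z' [b12 [b13 [b19 [arr' [w' s' zs' ->]]]]]].
    rewrite subnn muln0 addn0 in w' zs' *.
    by apply: (q _ z') => //; rewrite [RHS]/= jr -w'.
  move=> jr; assign.
  have -> : seedlen n e j + 5 * e j - (e j + (e j + (e j + (e j + e j)))) = seedlen n e j.
    by lia.
  apply: (q _ z) => //; first by rewrite [RHS]/= jr.
  by move=> p pl; apply: zs; rewrite (leq_trans pl)//= leq_addr.
have : e j * (8 * M + 20 + 3) <= M * (8 * M + 23) by apply: leq_mul; lia.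
by lia.
Qed.

Lemma wp_point (J l L M i : nat) (sd : nat -> bool) (e := steps l J L) (m := seedlen n e J)
    a0 a1 a2 a7 a8 a9 a10 a11 a12 a13 a14 a16 a17 a18 a19 a20 arr rm tp ak rs Q :
  m <= M -> J <= M ->
  (forall p, p < m -> arr p = sd p) ->
  (forall p, p < m -> arr (m + p) = sd p) ->
  (forall b7 b8 b9 b10 b11 b12 b13 b16 b17 b18 b19 arr',
    (forall p, p < m -> arr' p = sd p) ->
    (forall p, p < n -> arr' (m + p) = point n e J i sd p) ->
    Q (State (nmemory [:: a0; a1; a2; J; l; L; m; b7; b8; b9; b10; b11;
      b12; b13; a14; i; b16; b17; b18; b19; a20] arr') rm tp ak rs)) ->
  wp g point_com (M * (M * (8 * M + 29) + 53) + 10) Q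
    (State (nmemory [:: a0; a1; a2; J; l; L; m; a7; a8; a9; a10; a11;
      a12; a13; a14; i; a16; a17; a18; a19; a20] arr) rm tp ak rs).
Proof.
move=> mM JM seed zs q; eapply wp_le.
  eapply wp_seq; assign.
  eapply wp_seq; assign.
  eapply (@wp_for _ _ _ _ (fun t st => exists rem z b7 b8 b9 b12 b13 b17 b18 b19 arr', [/\
    point n e (J - t) rem z = point n e J i sd,
    (forall p, p < m -> arr' p = sd p),
    (forall p, p < seedlen n e (J - t) -> arr' (m + p) = z p) &
    st = State (nmemory [:: a0; a1; a2; J; l; L; m; b7; b8; b9; rem; seedlen n e (J - t);
      b12; b13; a14; i; t; b17; b18; b19; a20] arr') rm tp ak rs]) J).
  - exists i, sd, a7, a8, a9, a12, a13, a17, a18, a19, arr; rewrite subn0.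
    by split=> //; ev.
  - by move=> t st _ [rem [z [b7 [b8 [b9 [b12 [b13 [b17 [b18 [b19 [arr' [_ _ _ ->]]]]]]]]]]]]; ev.
  - move=> t st tJ [rem [z [b7 [b8 [b9 [b12 [b13 [b17 [b18 [b19 [arr' [pE s' z' ->]]]]]]]]]]]].
    have JE : J - t = (J - t.+1).+1 by lia.
    rewrite JE in pE z' *.
    eapply wp_level; [exact: tJ|exact: mM|exact: JM|exact: s'|exact: z'|].
    move=> rem2 z2 c7 c8 c9 c12 c13 c17 c18 c19 arr2 pE2 s2 zs2.
    exists rem2, z2, c7, c8, c9, c12, c13, c17, c18, c19, arr2; split=> //.
      by rewrite pE2.
    by ev; rewrite addn1.
  move=> st [rem [z [b7 [b8 [b9 [b12 [b13 [b17 [b18 [b19 [arr' [pE s' z' ->]]]]]]]]]]]].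
  rewrite subnn in pE z' *; rewrite /= in pE.
  by apply: q => //; rewrite -pE.
have : J * (M * (8 * M + 29) + 50 + 3) <= M * (M * (8 * M + 29) + 53).
  by apply: leq_mul => //; lia.
by lia.
Qed.

End Points.

(** * One round of the steward *)

Definition copy_com : com :=
  For 17 (V 6) (NSet (work (V 17)) (NLoad (NAdd (C 24) (V 17)))).

Definition shift_com : com :=
  4 :=R RNat (C 0) ;; 5 :=R RNat (C 0) ;;
  For 20 (NAdd (V 2) (C 1)) (
    14 :=N C 1 ;;
    For 17 (V 2) (
      let w := RAdd (RLoad (NAdd (C 8) (V 17))) (RV 4) in
      If (RLe (RRound (RAdd w (RV 0)) (RV 3)) (RRound (RSub w (RV 0)) (RV 3)))
        Skip (14 :=N C 0)) ;;
    If (NLe (C 1) (V 14)) (5 :=R RV 4) Skip ;;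
    4 :=R RAdd (RV 4) (RAdd (RV 0) (RV 0))).

Definition round_com : com :=
  For 17 (V 2) (RSet (NAdd (C 8) (V 17))
    (RRound (RAdd (RLoad (NAdd (C 8) (V 17))) (RV 5)) (RV 3))).

Definition body_com : com :=
  copy_com ;; point_com ;; Query (NAdd (C 24) (V 6)) (C 8) ;;
  shift_com ;; round_com ;; Answer (C 8).

Section Round.
Context {R : realType} {n d : nat}.
Variable g : seq 'rV[R]_d -> n.-tuple bool -> 'rV[R]_d.
Implicit Types (rm : nat -> R) (tp : seq bool) (ak : bool) (rs : seq 'rV[R]_d)
  (Q : state R d -> Prop) (arr : nat -> nat) (warr : nat -> R).

Lemma wp_copy m (sd : nat -> bool)
    a0 a1 a2 a3 a4 a5 a7 a8 a9 a10 a11 a12 a13 a14 a15 a16 a17 a18 a19 a20 arr rm tp ak rs Q :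
  (forall p, p < m -> arr p = sd p) ->
  (forall arr', (forall p, p < m -> arr' p = sd p) ->
    (forall p, p < m -> arr' (m + p) = sd p) ->
    Q (State (nmemory [:: a0; a1; a2; a3; a4; a5; m; a7; a8; a9; a10; a11; a12; a13; a14; a15;
       a16; m; a18; a19; a20] arr') rm tp ak rs)) ->
  wp g copy_com (m * 4 + 3) Q (State (nmemory [:: a0; a1; a2; a3; a4; a5; m; a7; a8; a9; a10;
    a11; a12; a13; a14; a15; a16; a17; a18; a19; a20] arr) rm tp ak rs).
Proof.
move=> seed q.
apply: (@wp_for _ _ _ _ (fun i st => exists arr', [/\
   (forall p, p < m -> arr' p = sd p), (forall p, p < i -> arr' (m + p) = sd p) &
   st = State (nmemory [:: a0; a1; a2; a3; a4; a5; m; a7; a8; a9; a10; a11; a12; a13; a14; a15;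
       a16; i; a18; a19; a20] arr') rm tp ak rs]) m 1).
- by exists arr; split=> //; ev.
- by move=> i st _ [arr' [_ _ ->]]; ev.
- move=> i st im [arr' [s' z' ->]]; assign.
  exists (upd arr' (m + i) (sd i)); split.
  + by move=> p pm; rewrite /upd ltn_eqF ?s'// (leq_trans pm)// leq_addr.
  + move=> p; rewrite ltnS leq_eqVlt /upd eqn_add2l; case: eqP => [->//|_] /= pi.
    exact: z'.
  + by rewrite addn1 s'.
- by move=> st [arr' [s' z' ->]]; exact: q.
Qed.

Lemma wp_shift eps r1 r2 r4 r5 (W : 'rV[R]_d)
    a0 a1 a3 a4 a5 a6 a7 a8 a9 a10 a11 a12 a13 a14 a15 a16 a17 a18 a19 a20
    arr warr tp ak rs Q :
  (forall j : 'I_d, warr j = W 0%R j) ->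
  (forall b14 b17 b20 s4,
    Q (State (nmemory [:: a0; a1; d; a3; a4; a5; a6; a7; a8; a9; a10; a11; a12; a13; b14; a15;
      a16; b17; a18; a19; b20] arr)
      (rmemory [:: eps; r1; r2; grid d eps; s4; offset eps (last_good eps W d.+1)] warr)
      tp ak rs)) ->
  wp g shift_com (d.+1 * (6 * d + 14) + 7) Q
    (State (nmemory [:: a0; a1; d; a3; a4; a5; a6; a7; a8; a9; a10;
    a11; a12; a13; a14; a15; a16; a17; a18; a19; a20] arr)
    (rmemory [:: eps; r1; r2; grid d eps; r4; r5] warr) tp ak rs).
Proof.
move=> wW q; eapply wp_le.
  eapply wp_seq; assign.
  eapply wp_seq; assign.
  eapply (@wp_for _ _ _ _ (fun c st => exists b14 b17,
    st = (State (nmemory [:: a0; a1; d; a3; a4; a5; a6; a7; a8; a9; a10; a11; a12; a13; b14; a15;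
      a16; b17; a18; a19; c] arr)
      (rmemory [:: eps; r1; r2; grid d eps; offset eps c; offset eps (last_good eps W c)] warr)
      tp ak rs)) d.+1).
  - by exists a14, a17; ev.
  - by move=> i st _ [b14 [b17 ->]]; ev; rewrite addn1.
  - move=> c st cd [b14 [b17 ->]].
    eapply wp_seq; assign.
    eapply wp_seq.
    pose ok j := (round_to (grid d eps) (warr j + offset eps c + eps) <=
      round_to (grid d eps) (warr j + offset eps c - eps))%R.
    eapply (@wp_for _ _ _ _ (fun i st =>
      st = (State (nmemory [:: a0; a1; d; a3; a4; a5; a6; a7; a8; a9; a10; a11; a12; a13;
        [forall j : 'I_d, (j < i) ==> ok j] : nat; a15; a16; i; a18; a19; c] arr)
      (rmemory [:: eps; r1; r2; grid d eps; offset eps c; offset eps (last_good eps W c)] warr)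
      tp ak rs)) d).
    + by ev; rewrite (_ : [forall j, _]); last by apply/forallP.
    + by move=> i st1 _ ->; ev.
    + move=> i st1 id ->.
      have okS : [forall j : 'I_d, (j < i.+1) ==> ok j] =
          [forall j : 'I_d, (j < i) ==> ok j] && ok i.
        apply/forallP/andP => [h|[/forallP h oi] j].
          split; last by have := h (Ordinal id); rewrite /= ltnSn.
          by apply/forallP => j; apply/implyP => ji; have := h j; rewrite ltnW.
        rewrite ltnS leq_eqVlt; apply/implyP => /orP[/eqP ->//|ji].
        by have := h j; rewrite ji.
      eapply wp_if; ev => oi.
        by eapply wp_skip; ev; rewrite okS /ok /round_to oi andbT addn1.
      by assign; rewrite okS /ok /round_to oi andbF addn1.
    move=> st1 ->.
    have goodE : [forall j : 'I_d, (j < d) ==> ok j] = good eps W c.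
      by apply: eq_forallb => j; rewrite ltn_ord /ok wW.
    rewrite goodE; eapply wp_seq; eapply wp_if; ev.
      move=> gc; assign; assign; exists (good eps W c : nat), d.
      by rewrite addn1 /= (_ : good eps W c)//; [rewrite addrC -mulrS|move: gc; case: good].
    move=> gc; eapply wp_skip; assign; exists (good eps W c : nat), d.
    by rewrite addn1 /= (_ : good eps W c = false); [rewrite addrC -mulrS|move: gc; case: good].
  by move=> st [b14 [b17 ->]]; exact: q.
by lia.
Qed.

Lemma wp_round gr off r0 r1 r2 r4
    a0 a1 a3 a4 a5 a6 a7 a8 a9 a10 a11 a12 a13 a14 a15 a16 a17 a18 a19 a20
    arr warr tp ak rs Q :
  (forall warr', (forall j, j < d -> warr' j = round_to gr (warr j + off)%R) ->
    Q (State (nmemory [:: a0; a1; d; a3; a4; a5; a6; a7; a8; a9; a10; a11; a12; a13; a14; a15;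
      a16; d; a18; a19; a20] arr) (rmemory [:: r0; r1; r2; gr; r4; off] warr') tp ak rs)) ->
  wp g round_com (d * 4 + 3) Q
    (State (nmemory [:: a0; a1; d; a3; a4; a5; a6; a7; a8; a9; a10;
    a11; a12; a13; a14; a15; a16; a17; a18; a19; a20] arr)
    (rmemory [:: r0; r1; r2; gr; r4; off] warr) tp ak rs).
Proof.
move=> q.
apply: (@wp_for _ _ _ _ (fun i st => st =
   (State (nmemory [:: a0; a1; d; a3; a4; a5; a6; a7; a8; a9; a10; a11; a12; a13; a14; a15;
      a16; i; a18; a19; a20] arr) (rmemory [:: r0; r1; r2; gr; r4; off]
      (fun j => if j < i then round_to gr (warr j + off)%R else warr j)) tp ak rs)) d 1).
- by ev.
- by move=> i st _ ->; ev.
- move=> i st id ->; assign; rewrite addn1 ltnn.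
  congr (State _ (rmemory _ _) _ _ _); apply/funext => j; rewrite /upd ltnS.
  by case: ltngtP => // ->.
- by move=> st ->; apply: q => j ->.
Qed.

Lemma wp_body eps r1 r2 r4 r5 (J l L M i : nat) (sd : nat -> bool)
    (e := steps l J L) (m := seedlen n e J)
    a0 a1 a7 a8 a9 a10 a11 a12 a13 a14 a16 a17 a18 a19 a20 arr warr tp rs Q :
  m <= M -> J <= M -> d.+1 <= M ->
  (forall p, p < m -> arr p = sd p) ->
  (forall b7 b8 b9 b10 b11 b12 b13 b14 b16 b17 b18 b19 b20 s4 s5 arr' warr',
    (forall p, p < m -> arr' p = sd p) ->
    Q (State (nmemory [:: a0; a1; d; J; l; L; m; b7; b8; b9; b10; b11;
      b12; b13; b14; i; b16; b17; b18; b19; b20] arr')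
      (rmemory [:: eps; r1; r2; grid d eps; s4; s5] warr') tp false
      (rcons rs (answer eps (g rs (query_point n (point n e J i sd))))))) ->
  wp g body_com (M * (M * (8 * M + 35) + 80) + 50) Q
    (State (nmemory [:: a0; a1; d; J; l; L; m; a7; a8; a9; a10; a11;
      a12; a13; a14; i; a16; a17; a18; a19; a20] arr)
      (rmemory [:: eps; r1; r2; grid d eps; r4; r5] warr) tp false rs).
Proof.
move=> mM JM dM seed q; eapply wp_le.
  eapply wp_seq; eapply wp_copy; first exact: seed.
  move=> arr1 seed1 z1.
  eapply wp_seq; eapply wp_point; [exact: mM|exact: JM|exact: seed1|exact: z1|].
  move=> b7 b8 b9 b10 b11 b12 b13 b16 b17 b18 b19 arr2 seed2 z2.
  eapply wp_seq; eapply wp_query.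
  rewrite /= nmemory_reg//=.
  have -> : read_point n (nmemory [:: a0; a1; d; J; l; L; seedlen n (steps l J L) J;
      b7; b8; b9; b10; b11; b12; b13; a14; i; b16; b17; b18; b19; a20] arr2)
      (24 + seedlen n (steps l J L) J) = query_point n (point n e J i sd).
    apply: eq_from_tnth => p; rewrite !tnth_mktuple -addnA nmemory_arr z2//.
    by case: (point _ _ _ _ _ _).
  set W := g rs _.
  have -> : write_vec (rmemory [:: eps; r1; r2; grid d eps; r4; r5] warr) 8 W =
      rmemory [:: eps; r1; r2; grid d eps; r4; r5]
       (fun j => if insub j is Some i then W 0%R i else warr j).
    by apply/funext => a; rewrite /write_vec /rmemory; case: (ltnP a 8).
  eapply wp_seq; eapply wp_shift with (W := W).
    by move=> j; rewrite valK.
  move=> b14 b17' b20 s4.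
  eapply wp_seq; eapply wp_round => warr' wE.
  eapply wp_answer => /=.
  have -> : read_vec d (rmemory [:: eps; r1; r2; grid d eps; s4;
      offset eps (last_good eps W d.+1)] warr') 8 = answer eps W.
    by apply/rowP => j; rewrite !mxE rmemory_arr wE//= valK.
  exact: q.
have h1 : d.+1 * (6 * d + 14) <= M * (6 * M + 14) by apply: leq_mul => //; lia.
have h2 : M * (6 * M + 14) = M * (6 * M) + M * 14 by rewrite mulnDr.
have h3 : M * (M * (8 * M + 29) + 53) = M * (M * (8 * M)) + M * (M * 29) + M * 53.
  by rewrite !mulnDr.
have h4 : M * (M * (8 * M + 35) + 80) = M * (M * (8 * M)) + M * (M * 35) + M * 80.
  by rewrite !mulnDr.
have h5 : M * (6 * M) = 6 * (M * M) by rewrite mulnCA.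
have h6 : M * (M * 35) = 35 * (M * M) /\ M * (M * 29) = 29 * (M * M) by split; lia.
by case: h6 => h6 h7; lia.
Qed.

End Round.

(** * The complete program *)

Definition params_com : com :=
  If (NLe (C 1) (V 2)) (8 :=N V 1) Skip ;; log_up ;; 3 :=N V 9 ;;
  8 :=N NAdd (V 2) (C 2) ;; log_up ;; 4 :=N V 9 ;;
  3 :=R RV 2 ;;
  While (RLe (RV 3) (RNat (C 1)))
    (3 :=R RAdd (RV 3) (RV 3) ;; 5 :=N NAdd (V 5) (C 1)).

Definition seed_com : com :=
  6 :=N V 0 ;; 8 :=N V 4 ;;
  For 16 (V 3) (steps_com ;; 6 :=N NAdd (V 6) (times5 (V 9)) ;; 8 :=N NAdd (V 8) (V 8)) ;;
  For 17 (V 6) (Flip (NAdd (C 24) (V 17))) ;;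
  3 :=R RNat (C 0) ;;
  For 17 (NAdd (V 2) (C 1)) (3 :=R RAdd (RV 3) (RAdd (RV 0) (RV 0))).

Definition steward : com := params_com ;; seed_com ;; For 15 (V 1) body_com.

(* For [d = 0] the seed is a single point: the bound leaves no bit beyond the first [n]. *)
Definition depth (k d : nat) : nat := up_log 2 (if 0 < d then k else 0).

Section Steward.
Context {R : realType} {n d : nat}.
Variable g : seq 'rV[R]_d -> n.-tuple bool -> 'rV[R]_d.
Implicit Types (rm : nat -> R) (tp : seq bool) (ak : bool) (rs : seq 'rV[R]_d)
  (Q : state R d -> Prop) (arr : nat -> nat) (warr : nat -> R).

(** [L] is found by counting doublings of [gamma] until it exceeds 1, since reals influence the
    naturals only through tests. *)
Lemma wp_params (k L M : nat) (eps delta gamma : R) warr tp ak rs Q :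
  (forall i, i < L -> (gamma *+ (2 ^ i)%N <= 1)%R) -> (1 < gamma *+ (2 ^ L)%N)%R ->
  k <= M -> d.+2 <= M -> L <= M ->
  (forall b7 b8 b9 b17 r3, Q (State (nmemory [:: n; k; d; depth k d; up_log 2 d.+2; L; 0;
    b7; b8; b9; 0;
    0; 0; 0; 0; 0; 0; b17; 0; 0; 0] (fun=> 0))
    (rmemory [:: eps; delta; gamma; r3; 0; 0]%R warr) tp ak rs)) ->
  wp g params_com (20 * M + 50) Q
   (State (nmemory [:: n; k; d; 0; 0; 0; 0; 0; 0; 0; 0;
    0; 0; 0; 0; 0; 0; 0; 0; 0; 0] (fun=> 0))
    (rmemory [:: eps; delta; gamma; 0; 0; 0]%R warr) tp ak rs).
Proof.
move=> Lle Lgt kM dM LM q; eapply wp_le.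
  eapply wp_seq.
  apply: (@wp_le _ _ _ _ 3 3); last exact: leqnn.
  set kk := if 0 < d then k else 0.
  have st1 Q' : Q' (State (nmemory [:: n; k; d; 0; 0; 0; 0; 0; kk; 0; 0;
      0; 0; 0; 0; 0; 0; 0; 0; 0; 0] (fun=> 0))
      (rmemory [:: eps; delta; gamma; 0; 0; 0]%R warr) tp ak rs) ->
    wp g (If (NLe (C 1) (V 2)) (8 :=N V 1) Skip) 3 Q'
    (State (nmemory [:: n; k; d; 0; 0; 0; 0; 0; 0; 0; 0;
      0; 0; 0; 0; 0; 0; 0; 0; 0; 0] (fun=> 0))
      (rmemory [:: eps; delta; gamma; 0; 0; 0]%R warr) tp ak rs).
    rewrite /kk => q'; apply: (@wp_if _ _ _ _ 1 1); ev => d0.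
      by assign; rewrite d0 in q'.
    by eapply wp_skip; rewrite d0 in q'.
  apply: st1.
  eapply wp_seq.
  apply: (@wp_le _ _ _ _ (8 * kk + 7) (8 * M + 7)); last first.
    by rewrite leq_add2r leq_mul2l /= /kk; case: ifP.
  apply: wp_log_up; rewrite -[up_log 2 kk]/(depth k d).
  eapply wp_seq; assign.
  eapply wp_seq; assign.
  eapply wp_seq.
  apply: (@wp_le _ _ _ _ (8 * (d + 2) + 7) (8 * M + 7)); last first.
    by rewrite leq_add2r leq_mul2l /= addn2.
  apply: wp_log_up; rewrite addn2.
  eapply wp_seq; assign.
  eapply wp_seq; assign.
  eapply (@wp_while _ _ _ _ (fun i st => exists b7 b8 b9 b17,
    st = (State (nmemory [:: n; k; d; depth k d; up_log 2 d.+2; i; 0; b7; b8; b9; 0;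
    0; 0; 0; 0; 0; 0; b17; 0; 0; 0] (fun=> 0))
    (rmemory [:: eps; delta; gamma; gamma *+ (2 ^ i)%N; 0; 0]%R warr) tp ak rs)) L).
  - by do 4 eexists; rewrite expn0 mulr1n.
  - move=> i st iL [b7 [b8 [b9 [b17 ->]]]]; split; first by ev; exact: Lle.
    eapply wp_seq; assign; assign; exists b7, b8, b9, b17.
    by rewrite addn1 expnS mul2n -addnn mulrnDr.
  - move=> st [b7 [b8 [b9 [b17 ->]]]]; split; last exact: q.
    by ev; apply/negbTE; rewrite -ltNge.
by lia.
Qed.

Lemma wp_seed (k J l L M : nat) (eps delta gamma : R) (e := steps l J L) (m := seedlen n e J)
   (s : seq bool) b7 b8 b9 b17 r3 warr ak rs Q :
  size s = m -> m <= M -> J <= M -> d.+1 <= M ->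
  (forall c7 c8 c9 c16 c17 arr, (forall p, p < m -> arr p = nth false s p) ->
    Q (State (nmemory [:: n; k; d; J; l; L; m; c7; c8; c9; 0;
    0; 0; 0; 0; 0; c16; c17; 0; 0; 0] arr)
    (rmemory [:: eps; delta; gamma; grid d eps; 0; 0]%R warr) [::] ak rs)) ->
  wp g seed_com (30 * M + 50) Q (State (nmemory [:: n; k; d; J; l; L; 0; b7; b8; b9; 0;
    0; 0; 0; 0; 0; 0; b17; 0; 0; 0] (fun=> 0))
    (rmemory [:: eps; delta; gamma; r3; 0; 0]%R warr) s ak rs).
Proof.
move=> sm mM JM dM q; eapply wp_le.
  eapply wp_seq; assign.
  eapply wp_seq; assign.
  eapply wp_seq.
  eapply (@wp_for _ _ _ _ (fun i st => exists b9, st =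
    State (nmemory [:: n; k; d; J; l; L; seedlen n e i; b7; 2 ^ i * l; b9; 0;
    0; 0; 0; 0; 0; i; b17; 0; 0; 0] (fun=> 0))
    (rmemory [:: eps; delta; gamma; r3; 0; 0]%R warr) s ak rs) J).
  - by exists b9; ev; rewrite mul1n.
  - by move=> i st _ [c9 ->]; ev.
  - move=> i st iJ [c9 ->]; eapply wp_seq; apply: wp_steps.
    rewrite -/(steps l J L i) -/e; eapply wp_seq; assign; assign.
    exists (e i); rewrite (_ : e i + (e i + (e i + (e i + e i))) = 5 * e i); last by lia.
    by rewrite addn1 addnn -mul2n mulnA -expnS.
  move=> st [c9 ->]; rewrite -/m.
  eapply wp_seq.
  eapply (@wp_for _ _ _ _ (fun i st => exists arr, (forall p, p < i -> arr p = nth false s p) /\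
    st = State (nmemory [:: n; k; d; J; l; L; m; b7; 2 ^ J * l; c9; 0;
    0; 0; 0; 0; 0; J; i; 0; 0; 0] arr)
    (rmemory [:: eps; delta; gamma; r3; 0; 0]%R warr) (drop i s) ak rs) m).
  - by exists (fun=> 0); split=> //; ev; rewrite drop0.
  - by move=> i st1 _ [arr [_ ->]]; ev.
  - move=> i st1 im [arr [ar ->]]; rewrite [drop i s](drop_nth false) ?sm//; eapply wp_flip; ev.
    exists (upd arr i (nth false s i)); split; last by rewrite addn1.
    move=> p; rewrite ltnS leq_eqVlt /upd; case: eqP => [->//|_] /= pi; exact: ar.
  move=> st1 [arr [ar ->]]; rewrite drop_oversize ?sm//.
  eapply wp_seq; assign.
  eapply (@wp_for _ _ _ _ (fun i st => st =
    State (nmemory [:: n; k; d; J; l; L; m; b7; 2 ^ J * l; c9; 0;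
    0; 0; 0; 0; 0; J; i; 0; 0; 0] arr)
    (rmemory [:: eps; delta; gamma; (eps + eps) *+ i; 0; 0]%R warr) [::] ak rs) d.+1).
  - by ev.
  - by move=> i st2 _ ->; ev; rewrite addn1.
  - by move=> i st2 _ ->; assign; rewrite addn1 mulrSr.
  - by move=> st2 ->; exact: q.
by lia.
Qed.

Lemma wp_steward (k L M : nat) (eps delta gamma : R) (J := depth k d)
    (e := steps (up_log 2 d.+2) J L) (m := seedlen n e J) (s : seq bool) :
  size s = m ->
  (forall i, i < L -> (gamma *+ (2 ^ i)%N <= 1)%R) -> (1 < gamma *+ (2 ^ L)%N)%R ->
  m <= M -> J <= M -> k <= M -> d.+2 <= M -> L <= M ->
  wp g steward (M * (M * (M * (8 * M + 35) + 80) + 110) + 130)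
    (fun st => asked st = false /\
       replies st = replies_to eps g (mkseq (fun i => point n e J i (nth false s)) k))
    (State (nth 0 [:: n; k; d]) (nth 0%R [:: eps; delta; gamma]) s false [::]).
Proof.
move=> sm Lle Lgt mM JM kM dM LM.
have -> : nth 0 [:: n; k; d] = nmemory [:: n; k; d; 0; 0; 0; 0; 0; 0; 0; 0;
    0; 0; 0; 0; 0; 0; 0; 0; 0; 0] (fun=> 0).
  apply/funext => a; rewrite /nmemory; case: ltnP => h.
    by do 24 (case: a h => [//|a] h).
  by rewrite nth_default// (leq_trans _ h).
have -> : nth 0%R [:: eps; delta; gamma] = rmemory [:: eps; delta; gamma; 0; 0; 0]%R (fun=> 0%R).
  apply/funext => a; rewrite /rmemory; case: ltnP => h.
    by do 8 (case: a h => [//|a] h).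
  by rewrite nth_default// (leq_trans _ h).
eapply wp_le.
  eapply wp_seq.
  eapply wp_params; [exact: Lle|exact: Lgt|exact: kM|exact: dM|exact: LM|].
  move=> b7 b8 b9 b17 r3.
  eapply wp_seq; eapply wp_seed; [exact: sm|exact: mM|exact: JM|exact: ltnW|].
  move=> c7 c8 c9 c16 c17 arr ar.
  eapply (@wp_for _ _ _ _ (fun i st =>
    exists b7 b8 b9 b10 b11 b12 b13 b14 b16 b17 b18 b19 b20 s4 s5 arr' warr',
    (forall p, p < m -> arr' p = nth false s p) /\
    st = State (nmemory [:: n; k; d; J; up_log 2 d.+2; L; m; b7; b8; b9; b10; b11;
      b12; b13; b14; i; b16; b17; b18; b19; b20] arr')
      (rmemory [:: eps; delta; gamma; grid d eps; s4; s5] warr') [::] false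
      (replies_to eps g (mkseq (fun i => point n e J i (nth false s)) i))) k).
  - by do 15 eexists; exists arr, (fun=> 0%R); split=> //; ev.
  - move=> i st _ [? [? [? [? [? [? [? [? [? [? [? [? [? [? [? [? [? [_ ->]]]]]]]]]]]]]]]]]].
    by ev.
  - move=> i st ik [? [? [? [? [? [? [? [? [? [? [? [? [? [? [? [? [? [ar' ->]]]]]]]]]]]]]]]]]].
    eapply wp_body; [exact: mM|exact: JM|exact: ltnW|exact: ar'|].
    move=> d7 d8 d9 d10 d11 d12 d13 d14 d16 d17 d18 d19 d20 s4 s5 arr2 warr2 ar2.
    exists d7, d8, d9, d10, d11, d12, d13, d14, d16, d17, d18, d19, d20, s4, s5, arr2, warr2.
    split=> //; ev; rewrite addn1; congr (State _ _ _ _ _).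
    by rewrite /replies_to mkseqS foldl_rcons.
  - by move=> st [? [? [? [? [? [? [? [? [? [? [? [? [? [? [? [? [? [_ ->]]]]]]]]]]]]]]]]]].
have : k * (M * (M * (8 * M + 35) + 80) + 50 + 3) <= M * (M * (M * (8 * M + 35) + 80) + 53).
  by apply: leq_mul => //; lia.
by rewrite !(mulnDr M (M * _)); lia.
Qed.

End Steward.

End Programs.

(** * Resource bounds *)

(** Tonelli for a finite family: the number of events that occur is bounded at each [w], then
    integrated. *)
Lemma sum_measure_le (R : realType) (disp : measure_display) (T : measurableType disp)
    (P : probability T R) (I : finType) (F : I -> set T) (c : R) :
  (forall i, measurable (F i)) -> (forall w, \sum_i (\1_(F i) w) <= c :> R) ->
  (\sum_i P (F i) <= c%:E)%E.
Proof.
move=> mF Fc.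
have -> : (\sum_i P (F i) = \int[P]_(w in setT) \sum_i (\1_(F i) w)%:E)%E.
  rewrite ge0_integral_sum//.
    by apply: eq_bigr => i _; rewrite integral_indic// setIT.
  by move=> i; apply/measurable_EFinP; exact: measurable_indic.
rewrite -[leRHS]mule1 -(probability_setT P) -integral_cst//.
apply: ge0_le_integral => //.
- by move=> w _; apply: sume_ge0 => i _; rewrite lee_fin.
- apply: emeasurable_sum => i; apply/measurable_EFinP; exact: measurable_indic.
- by move=> w _; rewrite sumEFin lee_fin.
Qed.

Section Analysis.
Context {R : realType}.

Lemma log2_pow_le (i : nat) (x : R) : 2 ^+ i <= x -> i%:R <= log2 x.
Proof.
move=> ix; have x0 : 0 < x by apply: lt_le_trans ix; rewrite exprn_gt0.
rewrite /log2 ler_pdivlMr ?ln_gt0 ?ltr1n// mulr_natl -lnXn//.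
by rewrite ler_ln// posrE// exprn_gt0.
Qed.

Lemma log2_nat_ge0 (k : nat) : 0 <= log2 (k%:R : R).
Proof.
case: k => [|k]; first by rewrite /log2 ln0// mul0r.
by rewrite /log2 divr_ge0// ln_ge0// ler1n.
Qed.

Lemma log_inv_ge0 (x : R) : 0 <= log_inv x.
Proof. by rewrite /log_inv le_max lexx. Qed.

(** [L] is the least exponent with [gamma 2 ^ L > 1]. If positive, minimality gives
    [2 ^ (L - 1) <= 1 / gamma]; if 0, the truncation in [log_inv] gives the bound. *)
Lemma exists_halvings (gamma : R) : 0 < gamma -> exists L : nat,
  [/\ forall i, (i < L)%N -> gamma *+ (2 ^ i)%N <= 1, 1 < gamma *+ (2 ^ L)%N &
      L%:R <= log_inv gamma + 1].
Proof.
move=> g0.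
have ex : exists L, 1 < gamma *+ (2 ^ L)%N.
  exists (Num.bound gamma^-1); have := archi_boundP (ltW (_ : 0 < gamma^-1)).
  rewrite invr_gt0 => /(_ g0) h; rewrite -mulr_natl -ltr_pdivrMr// div1r.
  by apply: (lt_trans h); rewrite ltr_nat ltn_expl.
exists (ex_minn ex); case: ex_minnP => L Lgt Lmin; split=> //.
  by move=> i iL; rewrite leNgt; apply/negP => /Lmin; rewrite leqNgt iL.
case: L Lgt Lmin => [|L] Lgt Lmin; first by rewrite addr_ge0// log_inv_ge0.
rewrite -natr1 lerD2r /log_inv le_max; apply/orP; right.
apply: log2_pow_le; rewrite -[leRHS]mul1r ler_pdivlMr// -natrX mulr_natl.
by rewrite leNgt; apply/negP => /Lmin; rewrite ltnn.
Qed.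

(** One constant has to serve as both coefficient and exponent of the time bound. *)
Lemma pow_le_scaled (C D : nat) (x : R) : 1 <= x -> C%:R * x ^+ D <= (C + D)%:R * x ^+ (C + D).
Proof.
move=> x1; apply: ler_pM => //.
- by rewrite exprn_ge0// (le_trans ler01).
- by rewrite ler_nat leq_addr.
- by apply: ler_weXn2l => //; rewrite leq_addl.
Qed.

End Analysis.

(** * Seed length and running time in terms of the parameters *)

Section Sizes.
Local Open Scope nat_scope.

(** The terms [2 ^ j * l] form a geometric series and the others are the same at all levels;
    [160 = 5 * 32]. *)
Lemma seedlen_steps n l J L : seedlen n (steps l J L) J <= n + 160 * (2 ^ J * l + J * J + J * L).
Proof.
suff H j : seedlen n (steps l J L) j <= n + 160 * (2 ^ j * l + j * J + j * L) by exact: H.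
elim: j => [|j IH] /=; first by rewrite leq_addr.
have -> : 5 * steps l J L j = 160 * (2 ^ j * l + J + L) by rewrite /steps mulnA.
have -> : 2 ^ j.+1 * l = 2 ^ j * l + 2 ^ j * l by rewrite expnS -mulnA mul2n addnn.
have -> : j.+1 * J = J + j * J by rewrite mulSn.
have -> : j.+1 * L = L + j * L by rewrite mulSn.
move: IH; set u := seedlen _ _ _; have := leq0n (2 ^ j * l).
by move: (2 ^ j * l) (j * J) (j * L) u => *; lia.
Qed.

Lemma up_log2_le k : up_log 2 k <= k.
Proof. by apply: up_log_min => //; apply/ltnW/ltn_expl. Qed.

Lemma up_log2_exp k : 2 ^ up_log 2 k <= 2 * k + 1.
Proof.
have [k1|k1] := leqP k 1; first by move: k k1 => [|[|//]].
have := up_log_gtn (isT : 1 < 2) k1.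
have : 0 < up_log 2 k by rewrite up_log_gt0 k1.
by case: (up_log 2 k) => // j _ /=; rewrite expnS; lia.
Qed.

Lemma sqr_le_exp J : J * J <= 2 * 2 ^ J.
Proof.
have [J4|] := leqP J 3; first by move: J J4 => [|[|[|[|//]]]].
elim: J => // J IH; rewrite ltnS leq_eqVlt => /predU1P[<-//|J4].
by have := IH J4; rewrite expnS; nia.
Qed.

Definition running_time M := M * (M * (M * (8 * M + 35) + 80) + 110) + 130.

Lemma running_time_le M : 0 < M -> running_time M <= 363 * M ^ 4.
Proof.
move=> M0; have -> : running_time M =
    8 * M ^ 4 + 35 * M ^ 3 + 80 * M ^ 2 + 110 * M ^ 1 + 130 * M ^ 0.
  by rewrite /running_time !expnS expn0; lia.
have h i : i <= 4 -> M ^ i <= M ^ 4 by move=> i4; exact: leq_pexp2l.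
by have := h 3 isT; have := h 2 isT; have := h 1 isT; have := h 0 isT; lia.
Qed.

(** The seed accounts for [160 (4 + 1 + 1) = 960] and for [n]; what is left is linear in [N]. *)
Lemma total_size_le n k d L (J := depth k d) (l := up_log 2 d.+2) (N := n + k + d + L + 1) :
  seedlen n (steps l J L) J + J + k + d.+2 + L <= 964 * N ^ 2.
Proof.
have Jk : J <= k.
  by rewrite /J /depth; case: ifP => _ //; rewrite ?up_log0// up_log2_le.
have J2 : 2 ^ J <= 2 * k + 1.
  rewrite /J /depth; case: ifP => _; last by rewrite up_log0; lia.
  exact: up_log2_exp.
have ld : l <= d.+2 by exact: up_log2_le.
have N1 : 1 <= N by rewrite /N addn1.
have e1 : 2 ^ J * l <= (2 * N) * (2 * N) by apply: leq_mul; lia.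
have e2 : J * J <= N * N by apply: leq_mul; lia.
have e3 : J * L <= N * N by apply: leq_mul; lia.
have e4 : N <= N * N by rewrite leq_pmulr.
have := seedlen_steps n l J L; rewrite expnS expn1.
by move: e1; rewrite mulnACA; lia.
Qed.

End Sizes.

(** [2240 = 160 (4 + 4 + 4 + 2)], from the coefficients in [m2], [m3] and [m4]. *)
Lemma seed_bound (R : realType) (n k d L : nat) (gamma : R) :
  L%:R <= log_inv gamma + 1 ->
  (seedlen n (steps (up_log 2 d.+2) (depth k d) L) (depth k d))%:R <=
  n%:R + 2240%:R * (k%:R * log2 (d%:R + 1 : R) + log2 (k%:R : R) * log_inv gamma).
Proof.
move=> LB; set J := depth k d; set l := up_log 2 d.+2.
have g0 := log_inv_ge0 gamma.
have ld0 : 0 <= log2 (d%:R + 1 : R) by rewrite natr1 log2_nat_ge0.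
have lk0 := log2_nat_ge0 (R := R) k.
(* For [k <= 1] or [d = 0] the logarithms may vanish, but then the seed has exactly [n] bits. *)
have [J0|J0] := posnP J.
  rewrite J0 -[seedlen _ _ 0]/n lerDl; apply: mulr_ge0; first exact: ler0n.
  by apply: addr_ge0; apply: mulr_ge0.
have [d0 k1] : (0 < d)%N /\ (1 < k)%N.
  by move: J0; rewrite /J /depth; case: ifP => [d0|]; rewrite up_log_gt0 //= => ->.
have JE : J = up_log 2 k by rewrite /J /depth d0.
have := up_log_gtn (isT : (1 < 2)%N) k1; rewrite -JE => Jk.
have J2k : (2 ^ J <= 2 * k)%N.
  by rewrite -(prednK J0) expnS leq_mul2l ltnW.
have Jl : (J.-1)%:R <= log2 (k%:R : R).
  by apply: log2_pow_le; rewrite -natrX ler_nat ltnW.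
have lk1 : 1 <= log2 (k%:R : R).
  by apply: (@log2_pow_le _ 1); rewrite expr1 ler_nat.
have ld1 : 1 <= log2 (d%:R + 1 : R).
  by apply: (@log2_pow_le _ 1); rewrite expr1 natr1 ler_nat ltnS.
have l2 : l%:R <= 2 * log2 (d%:R + 1 : R).
  have -> : 2 * log2 (d%:R + 1 : R) = log2 ((d.+1 ^ 2)%N%:R : R).
    by rewrite /log2 natrX lnXn ?ltr0Sn// natr1 [RHS]mulrnAl mulr_natl.
  apply: log2_pow_le; rewrite -natrX ler_nat.
  have l0 : (0 < l)%N by rewrite up_log_gt0.
  have := up_log_gtn (isT : (1 < 2)%N) (isT : (1 < d.+2)%N).
  by rewrite -/l -[in (2 ^ l <= _)%N](prednK l0) expnS; nia.
have m1 : (seedlen n (steps l J L) J)%:R <= n%:R + 160 * ((2 ^ J * l)%N%:R +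
    (J * J)%N%:R + (J * L)%N%:R) :> R.
  by rewrite -!natrD -natrM -natrD ler_nat; exact: seedlen_steps.
have m2 : (2 ^ J * l)%N%:R <= 4 * (k%:R * log2 (d%:R + 1 : R)).
  apply: (@le_trans _ _ ((2 * k)%N%:R * (2 * log2 (d%:R + 1 : R)))).
    by rewrite natrM; apply: ler_pM => //; rewrite ler_nat.
  by rewrite natrM; lra.
have JJ : (J * J <= 4 * k)%N.
  by apply: leq_trans (sqr_le_exp J) _; rewrite -(mulnA 2 2 k) leq_mul2l.
have kl : k%:R <= k%:R * log2 (d%:R + 1 : R) by rewrite ler_peMr.
have m3 : (J * J)%N%:R <= 4 * (k%:R * log2 (d%:R + 1 : R)).
  apply: (@le_trans _ _ (4 * k)%N%:R); last by rewrite natrM; lra.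
  by rewrite ler_nat.
(* [L] may exceed [log_inv gamma] by 1; the extra [J] is at most [J * J <= 4 k] and goes into the
   other term. *)
have m4 : (J * L)%N%:R <= 2 * (log2 (k%:R : R) * log_inv gamma) + 4 * (k%:R * log2 (d%:R + 1 : R)).
  have J2 : J%:R <= 2 * log2 (k%:R : R).
    by rewrite -(prednK J0) -natr1; lra.
  apply: (@le_trans _ _ (J%:R * log_inv gamma + J%:R)).
    by rewrite natrM -[X in _ + X]mulr1 -mulrDr ler_wpM2l.
  apply: lerD; first by rewrite mulrA ler_wpM2r.
  apply: (@le_trans _ _ (4 * k)%N%:R); last by rewrite natrM; lra.
  by rewrite ler_nat (leq_trans _ JJ)// leq_pmulr.
have z : 0 <= log2 (k%:R : R) * log_inv gamma by rewrite mulr_ge0.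
have kl0 : 0 <= k%:R * log2 (d%:R + 1 : R) by rewrite mulr_ge0.
move: m1 m2 m3 m4 z kl0; rewrite -/J -/l; clear.
set a := (2 ^ J * l)%N%:R; set b := (J * J)%N%:R; set c := (J * L)%N%:R.
set x := k%:R * _; set y := _ * log_inv _.
lra.
Qed.

(** * Failure probability, randomness and time together *)

Lemma norm_rV0 (R : realType) (d : nat) (v : 'rV[R]_d) : d = 0%N -> `|v| = 0.
Proof. by move=> d0; subst d; rewrite thinmx0 normr0. Qed.

Theorem theorem1p3 (R : realType) :
  exists (p : com) (a b c : nat),
  forall (n k d : nat) (eps delta gamma : R),
    0 < eps -> 0 < delta -> 0 < gamma ->
    exists m t : nat,
      [/\ one_query_steward p n k d eps delta gamma m t
            (a%:R * (eps * d%:R)) (k%:R * delta + gamma),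
          m%:R <= n%:R + b%:R * (k%:R * log2 (d%:R + 1 : R)
                                 + log2 (k%:R : R) * log_inv gamma)
        & t%:R <= c%:R * (n%:R + k%:R + d%:R
                          + log_inv eps + log_inv gamma + 1) ^+ c ].
Proof.
(* The factors come from [running_time_le], [total_size_le] and [Nx] below; the equation keeps the
   numeral folded. *)
have [C CE] : exists C, C = (363 * 964 ^ 4 * 2 ^ 8)%N by eexists.
exists steward, 4%N, 2240%N, (C + 8)%N => n k d eps delta gamma eps0 delta0 gamma0.
have [L [Lle Lgt LB]] := exists_halvings gamma0.
set J := depth k d; set l := up_log 2 d.+2; set e := steps l J L.
set m := seedlen n e J.
pose M := (m + J + k + d.+2 + L)%N.
have [Mm MJ Mk Md ML] : [/\ m <= M, J <= M, k <= M, d.+2 <= M & L <= M]%N.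
  by rewrite /M; split; lia.
exists m, (running_time M); split.
- move=> disp T P O run failure.
  have runE w (s : m.-tuple bool) : exists st, [/\ run w s = ([::], st), asked st = false &
      replies st = replies_to eps (fct O w) (mkseq (fun i => point n e J i (nth false s)) k)].
    have [t [st [tT [st1 st2] h]]] :=
      @wp_steward R n d (fct O w) k L M eps delta gamma s (size_tuple s) Lle Lgt Mm MJ Mk Md ML.
    exists st; split=> //.
    rewrite /run /play /init -/(running_time M) in tT *.
    rewrite -(subnK tT) iterD h.
    (* The final configuration is a fixed point of [step]. *)
    by elim: (running_time M - t)%N => //= q ->; case: (st).
  split.
    move=> w s; have [st [-> a r]] := runE w s.
    by rewrite /completed /= a r size_replies_to size_mkseq eqxx.
  move=> mF.
  (* For fixed [w] the owner is deterministic, and the failing seeds are counted. *)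
  have pointwise w : \sum_(s : m.-tuple bool) \1_(failure s) w <=
      2 ^+ m * (k%:R * delta + gamma) :> R.
    have failE (s : m.-tuple bool) : \1_(failure s) w = (missed k eps (center O w)
        (replies_to eps (fct O w) (mkseq (fun i => point n e J i (nth false s)) k)))%:R :> R.
      have [st [rE _ rp]] := runE w s.
      rewrite indicE /missed; congr (nat_of_bool _)%:R.
      by apply/idP/asboolP; rewrite in_setE /failure /= rE /= rp.
    under eq_bigr => s _ do rewrite failE.
    (* For [d = 0] the generator yields a single point, but all norms vanish and no reply can
       miss. *)
    have [d0|d0] := posnP d.
      rewrite big1 => [|s _].
        by rewrite mulr_ge0// addr_ge0 ?mulr_ge0// ltW.
      rewrite /missed; case: asboolP => // -[i _].
      by rewrite norm_rV0// d0 mulr0 mulr0 ltxx.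
    have kJ : (k <= 2 ^ J)%N by rewrite /J /depth d0; exact: up_logP.
    have dl : (d.+2 <= 2 ^ l)%N by exact: up_logP.
    apply: (le_trans (replies_missed eps0 (ltW delta0) (fctP O w) L kJ dl)).
    (* [2 ^- L <= gamma] by the choice of [L]. *)
    rewrite ler_wpM2l// lerD2l -[leLHS]div1r ler_pdivrMr// -natrX mulr_natr.
    exact: ltW.
  have S := sum_measure_le P mF pointwise.
  apply: (le_trans (lee_wpmul2l _ S)); first by rewrite lee_fin invr_ge0.
  by rewrite -EFinM mulKf// expf_neq0.
- exact: seed_bound.
- have x1 : 1 <= n%:R + k%:R + d%:R + log_inv eps + log_inv gamma + 1 :> R.
    by rewrite lerDr !addr_ge0// log_inv_ge0.
  set x := _ + 1 in x1 *.
  apply: le_trans (pow_le_scaled C 8 x1).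
  pose N := (n + k + d + L + 1)%N.
  (* Rounding up in [L] costs at most 1, and [x + 1 <= 2 x]. *)
  have Nx : N%:R <= 2 * x.
    have := log_inv_ge0 eps; have := log_inv_ge0 gamma; have := ler0n R n.
    by have := ler0n R k; have := ler0n R d; rewrite /N !natrD /x; lra.
  have tN : (running_time M <= 363 * (964 ^ 4 * N ^ 8))%N.
    apply: leq_trans (running_time_le _) _; first by rewrite /M; lia.
    rewrite leq_mul2l /= (expnM N 2 4) -expnMn leq_exp2r//.
    exact: total_size_le.
  apply: (@le_trans _ _ (363 * (964 ^+ 4 * N%:R ^+ 8))).
    by rewrite -[in leRHS]natrX -[in leRHS]natrX -!natrM ler_nat.
  have -> : C%:R = 363 * (964 ^+ 4 * 2 ^+ 8) :> R by rewrite CE -mulnA 2!natrM 2!natrX.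
  have x0 : 0 <= x by exact: le_trans x1.
  have N8 : N%:R ^+ 8 <= 2 ^+ 8 * x ^+ 8.
    by rewrite -exprMn; apply: lerXn2r; rewrite ?nnegrE ?mulr_ge0.
  have scale (a b u v y : R) : 0 <= a -> 0 <= b -> u <= v * y -> a * (b * u) <= a * (b * v) * y.
    by move=> a0 b0 uv; rewrite -!mulrA !ler_wpM2l.
  by apply: scale N8; [exact: ler0n|apply: exprn_ge0; exact: ler0n].
Qed.
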